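(* Let $k>0$ (repulsive force) and let $c>0$ be a constant (background charge). Consider the one-dimensional Euler-Poisson system $$\rho_t+(\rho u)_x=0,\qquad u_t+uu_x=kE,\qquad E_x=\rho-c,\qquad x\in\mathbb{R},\ t>0,$$ with initial data $(\rho,u)(x,0)=(\rho_0,u_0)(x)$. It admits a global smooth solution if and only if $$|u_0'(\alpha)|<\sqrt{k(2\rho_0(\alpha)-c)}\qquad\forall\,\alpha\in\mathbb{R}.$$ In this case, the density oscillates around the nonzero background charge $c$, and the velocity gradient $u_x$ does not decay in time. If the condition fails, the solution breaks down at a finite time.
   Context: Initial data: $\rho_0,u_0\in C^1(\mathbb{R})$, $\rho_0>0$. Standing assumptions: $\int_{-\infty}^\infty(\rho(\xi,t)-c)\,d\xi=0$, $\rho(\pm\infty,t)=c$, $u(\pm\infty,t)=0$, and $E(x,t)=\int_{-\infty}^x(\rho(\xi,t)-c)\,d\xi$. Characteristics: $\frac{d}{dt}x(\alpha,t)=u(x(\alpha,t),t)$, $x(\alpha,0)=\alpha$. The condition is understood to require $2\rho_0(\alpha)-c>0$. The time behavior of $\rho$ and $u_x$ refers to their evolution along characteristics. A global smooth solution is a classical solution for all $t\ge0$ with $\rho$ and $u_x$ finite along the characteristics; ''breaks down'' means that $\rho$ and $u_x$ become unbounded along a characteristic in finite time.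
   Formalization: Assumes u_0'→0 at ±∞ (forced by ρ(±∞,t)=c); oscillation and non-decay exclude characteristics with ρ_0=c, u_0'=0, where ρ=c and u_x=0; the mass equation is read along characteristics, as ρ_x need not exist for C^1 data, and is recovered pointwise when u_0 is C^2. *)

(* Defs.v *)
From Stdlib Require Import Reals.
From Coquelicot Require Import Coquelicot.
Open Scope R_scope.

Definition dx (f : R -> R -> R) (x t : R) : R := Derive (fun y => f y t) x.
Definition dt (f : R -> R -> R) (x t : R) : R := Derive (fun s => f x s) t.

(* Space-time functions are total on R * R, but only their values for
   0 <= t < T matter; T = p_infty gives the half plane t >= 0. *)
Definition strip (T : Rbar) (p : R * R) : Prop :=
  0 <= snd p /\ Rbar_lt (snd p) T.

Definition C0_strip (T : Rbar) (f : R -> R -> R) : Prop :=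
  continuous_on (strip T) (fun p : R * R => f (fst p) (snd p)).

(* C^1 up to the initial line: the time derivative is taken for t > 0 and
   extends continuously to t = 0. *)
Definition C1_strip (T : Rbar) (f : R -> R -> R) : Prop :=
  C0_strip T f /\
  exists fx ft : R -> R -> R,
    C0_strip T fx /\ C0_strip T ft /\
    (forall x t, 0 <= t -> Rbar_lt t T ->
       is_derive (fun y => f y t) x (fx x t)) /\
    (forall x t, 0 < t -> Rbar_lt t T ->
       is_derive (fun s => f x s) t (ft x t)).

Definition C1 (f : R -> R) : Prop :=
  forall x, ex_derive f x /\ continuous (Derive f) x.

Definition C2 (f : R -> R) : Prop := C1 f /\ C1 (Derive f).

(* The far-field conditions are the traces at t = 0 of those imposed on a
   solution. The one on u0' does not follow from u0 -> 0, but is forced by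
   rho(+-oo, t) = c for t > 0: along the characteristic issued from a,
     rho = rho0(a) / G(a,t),
     G(a,t) = 1 + (rho0(a)/c - 1) (1 - cos wt) + u0'(a) sin(wt) / w,
   with w = sqrt (k c), so that rho -> c requires u0'(a) -> 0. *)
Record admissible_data (c : R) (rho0 u0 : R -> R) : Prop := {
  data_rho0_C1 : C1 rho0;
  data_u0_C1 : C1 u0;
  data_rho0_pos : forall a, 0 < rho0 a;
  data_neutral : is_RInt_gen (fun xi => rho0 xi - c)
                   (Rbar_locally m_infty) (Rbar_locally p_infty) 0;
  data_rho0_minfty : is_lim rho0 m_infty c;
  data_rho0_pinfty : is_lim rho0 p_infty c;
  data_u0_minfty : is_lim u0 m_infty 0;
  data_u0_pinfty : is_lim u0 p_infty 0;
  data_du0_minfty : is_lim (Derive u0) m_infty 0;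
  data_du0_pinfty : is_lim (Derive u0) p_infty 0
}.

Definition characteristic (T : Rbar) (u : R -> R -> R) (a : R) (X : R -> R)
  : Prop :=
  X 0 = a /\
  continuous_on (fun t : R => 0 <= t /\ Rbar_lt t T) X /\
  forall t, 0 < t -> Rbar_lt t T -> is_derive X t (u (X t) t).

(* Classical solution on 0 <= t < T.
   With u0 only C^1, rho is in general no better than continuous in x (it is
   rho0 / G, and G contains u0'), so rho_x need not exist. The mass equation
   rho_t + (rho u)_x = (rho_t + u rho_x) + rho u_x = 0 is therefore read with
   rho_t + u rho_x as the derivative of rho along the characteristics; for
   rho of class C^1 this is the equation itself. *)
Record solution (k c : R) (rho0 u0 : R -> R) (T : Rbar)
    (rho u E : R -> R -> R) : Prop := {
  sol_rho_C0 : C0_strip T rho;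
  sol_u_C1 : C1_strip T u;
  sol_E_C0 : C0_strip T E;
  sol_rho_init : forall x, rho x 0 = rho0 x;
  sol_u_init : forall x, u x 0 = u0 x;
  sol_characteristics : forall a, exists X, characteristic T u a X;
  sol_mass : forall a X, characteristic T u a X ->
    forall t, 0 < t -> Rbar_lt t T ->
      is_derive (fun s => rho (X s) s) t (- (rho (X t) t * dx u (X t) t));
  sol_momentum : forall x t, 0 < t -> Rbar_lt t T ->
    dt u x t + u x t * dx u x t = k * E x t;
  sol_poisson : forall x t, 0 <= t -> Rbar_lt t T ->
    is_derive (fun y => E y t) x (rho x t - c);
  sol_E_def : forall x t, 0 <= t -> Rbar_lt t T ->
    is_RInt_gen (fun xi => rho xi t - c)
      (Rbar_locally m_infty) (at_point x) (E x t);
  sol_neutral : forall t, 0 <= t -> Rbar_lt t T ->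
    is_RInt_gen (fun xi => rho xi t - c)
      (Rbar_locally m_infty) (Rbar_locally p_infty) 0;
  sol_rho_far : forall t, 0 <= t -> Rbar_lt t T ->
    is_lim (fun x => rho x t) m_infty c /\ is_lim (fun x => rho x t) p_infty c;
  sol_u_far : forall t, 0 <= t -> Rbar_lt t T ->
    is_lim (fun x => u x t) m_infty 0 /\ is_lim (fun x => u x t) p_infty 0
}.

Definition subcritical (k c : R) (rho0 u0 : R -> R) : Prop :=
  forall a, 0 < 2 * rho0 a - c /\
            Rabs (Derive u0 a) < sqrt (k * (2 * rho0 a - c)).

Definition oscillates_around (c : R) (f : R -> R) : Prop :=
  forall tau, exists t1 t2, tau < t1 /\ tau < t2 /\ f t1 < c /\ c < f t2.

Definition decays (f : R -> R) : Prop := is_lim f p_infty 0.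

Definition unbounded_before (T : R) (f : R -> R) : Prop :=
  forall M, exists t, 0 <= t < T /\ M < Rabs (f t).

(* Main.v *)
Require Import Defs.
From Stdlib Require Import Reals Lra Classical ClassicalEpsilon.
From Coquelicot Require Import Coquelicot.
Open Scope R_scope.

(* With w = sqrt(kc) and e(a) the integral of rho0 - c over (-oo, a], the system
   is a harmonic oscillator along characteristics:
     X(a,t) = a + (e(a)/c) (1 - cos wt) + (u0(a)/w) sin wt.
   Its label derivative is
     G(a,t) = 1 + ((rho0(a) - c)/c) (1 - cos wt) + (u0'(a)/w) sin wt,
   and rho = rho0/G, u_x = G_t/G. The minimum of G(a,.) is
     rho0/c - sqrt((rho0/c - 1)^2 + (u0'/w)^2),
   which is positive exactly when u0'^2 < k (2 rho0 - c).
   When G > 0 on [0,T), a |-> X(a,t) is a bijection of the line and its inverse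
   gives the solution. At a label where G first vanishes rho and u_x blow up; this
   first time is attained because G > 0 uniformly for large |a|.
   Conversely, let X be a characteristic of an arbitrary solution. As u is only
   C^1, u_x cannot be differentiated along X. Instead the difference quotient D of
   characteristics issued from a and a + h is shown, as h -> 0, to satisfy both
   D rho(X) -> rho0(a) (mass equation and Gronwall) and D -> G (momentum equation
   and Duhamel's formula), so that rho G = rho0. *)

(** * Calculus *)

(** The textbook route differentiates E along one characteristic, E' = -c u, which rests on E_t =
    -rho u. A [solution] supplies only E_x, so the oscillator is not read off a single
    characteristic: differencing two neighbours brings in E_x alone. The quotient D then obeys a
    closed equation because D rho is nearly constant: D'' is close to k (rho - c) D, hence to k
    (rho0 - c D), which is linear with frequency w. The price is that X is recovered only up to a
    translation depending on t, which the condition u -> 0 at infinity removes. The factor 2 rho0 -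
    c of the threshold comes from c (2 rho0 - c) = rho0^2 - (rho0 - c)^2, where rho0/c is the mean
    of G and rho0/c - 1 its cosine amplitude. *)

Lemma mean_value_open (f df : R -> R) (a b : R) :
  a < b ->
  (forall s, a <= s <= b -> continuity_pt f s) ->
  (forall s, a < s < b -> is_derive f s (df s)) ->
  exists s, a < s < b /\ f b - f a = df s * (b - a).
Proof.
intros hab hc hd.
assert (pr : forall s, a < s < b -> derivable_pt f s).
{ intros s hs; exists (df s); apply is_derive_Reals, hd, hs. }
destruct (MVT f id a b pr (fun s _ => derivable_pt_id s) hab hc) as [s [P H]].
{ intros; apply derivable_continuous_pt, derivable_pt_id. }
exists s; split; [exact P|].
rewrite derive_pt_id in H; unfold id in H.
assert (E : derive_pt f s (pr s P) = df s).
{ apply derive_pt_eq_0, is_derive_Reals, hd, P. }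
rewrite E in H; lra.
Qed.

Lemma continuity_pt_eps (f : R -> R) (x : R) :
  continuity_pt f x ->
  forall eps, 0 < eps -> exists d, 0 < d /\
    forall y, Rabs (y - x) < d -> Rabs (f y - f x) < eps.
Proof.
intros h eps he; destruct (h eps he) as [d [hd H]].
exists d; split; [exact hd|]; intros y hy.
destruct (Req_dec x y) as [<-|n].
- now rewrite Rminus_diag, Rabs_R0.
- apply H; split; [split; [exact I|exact n]|exact hy].
Qed.

Lemma eps_continuity_pt (f : R -> R) (x : R) :
  (forall eps, 0 < eps -> exists d, 0 < d /\
    forall y, Rabs (y - x) < d -> Rabs (f y - f x) < eps) ->
  continuity_pt f x.
Proof.
intros h eps he; destruct (h eps he) as [d [hd H]].
exists d; split; [exact hd|]; intros y [_ hy]; apply H, hy.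
Qed.

Lemma is_derive_continuity_pt (f : R -> R) (x l : R) :
  is_derive f x l -> continuity_pt f x.
Proof.
intro h; apply continuity_pt_filterlim, (ex_derive_continuous f); now exists l.
Qed.

Lemma is_derive_eps (f : R -> R) (x l : R) :
  (forall eps, 0 < eps -> exists d, 0 < d /\
     forall h, h <> 0 -> Rabs h < d -> Rabs ((f (x + h) - f x) / h - l) < eps) ->
  is_derive f x l.
Proof.
intro H; apply is_derive_Reals; intros eps he.
destruct (H eps he) as [d [hd H']]; exists (mkposreal d hd); exact H'.
Qed.

Lemma eps_is_derive (f : R -> R) (x l : R) :
  is_derive f x l ->
  forall eps, 0 < eps -> exists d, 0 < d /\
     forall h, h <> 0 -> Rabs h < d -> Rabs ((f (x + h) - f x) / h - l) < eps.
Proof.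
intros H eps he; apply is_derive_Reals in H.
destruct (H eps he) as [d H']; exists d; split; [apply cond_pos|exact H'].
Qed.

Lemma is_derive_eq (f : R -> R) (x l l' : R) :
  is_derive f x l -> l = l' -> is_derive f x l'.
Proof. now intros h <-. Qed.

Lemma is_derive_local (f g : R -> R) (x l d : R) :
  0 < d -> (forall y, Rabs (y - x) < d -> f y = g y) ->
  is_derive f x l -> is_derive g x l.
Proof.
intros hd he; apply is_derive_ext_loc.
exists (mkposreal d hd); intros y hy; apply he, hy.
Qed.

(* A factorisation f - f x = m (g - g x), with m -> m0 but m not assumed to be
   a function, transfers derivatives; the mean value theorem supplies such m. *)
Lemma is_derive_factor (f g : R -> R) (x g' m0 : R) :
  is_derive g x g' ->
  (forall eps, 0 < eps -> exists d, 0 < d /\ forall y, Rabs (y - x) < d ->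
     exists m, Rabs (m - m0) < eps /\ f y - f x = m * (g y - g x)) ->
  is_derive f x (m0 * g').
Proof.
intros hg hf; apply is_derive_eps; intros eps he.
pose proof (Rabs_pos g'); pose proof (Rabs_pos m0).
set (e1 := eps / 2 / (Rabs g' + 1)).
set (e2 := Rmin 1 (eps / 2 / (Rabs m0 + 1))).
assert (0 < e1) by (apply Rdiv_lt_0_compat; lra).
assert (0 < eps / 2 / (Rabs m0 + 1)) by (apply Rdiv_lt_0_compat; lra).
assert (0 < e2) by (apply Rmin_glb_lt; lra).
destruct (hf e1) as [d1 [hd1 Hf]]; [easy|].
destruct (eps_is_derive _ _ _ hg e2) as [d2 [hd2 Hg]]; [easy|].
exists (Rmin d1 d2); split; [now apply Rmin_glb_lt|].
intros h hh hd.
pose proof (Rmin_l d1 d2); pose proof (Rmin_r d1 d2).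
destruct (Hf (x + h)) as [m [hm ->]].
{ replace (x + h - x) with h by ring; lra. }
specialize (Hg h hh ltac:(lra)).
set (q := (g (x + h) - g x) / h) in *.
replace (m * (g (x + h) - g x) / h - m0 * g')
  with ((m - m0) * q + m0 * (q - g')) by (unfold q; field; exact hh).
eapply Rle_lt_trans; [apply Rabs_triang|]; rewrite !Rabs_mult.
assert (hq : Rabs q <= Rabs g' + 1).
{ pose proof (Rmin_l 1 (eps / 2 / (Rabs m0 + 1))) as hl; fold e2 in hl.
  replace q with (g' + (q - g')) by ring.
  eapply Rle_trans; [apply Rabs_triang|]; lra. }
assert (h1 : Rabs (m - m0) * Rabs q < e1 * (Rabs g' + 1)).
{ apply Rle_lt_trans with (Rabs (m - m0) * (Rabs g' + 1)).
  - apply Rmult_le_compat_l; [apply Rabs_pos|exact hq].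
  - apply Rmult_lt_compat_r; lra. }
assert (h2 : Rabs m0 * Rabs (q - g') <= Rabs m0 * (eps / 2 / (Rabs m0 + 1))).
{ apply Rmult_le_compat_l; [lra|].
  pose proof (Rmin_r 1 (eps / 2 / (Rabs m0 + 1))) as hl; fold e2 in hl; lra. }
assert (h3 : e1 * (Rabs g' + 1) = eps / 2) by (unfold e1; field; lra).
assert (h4 : Rabs m0 * (eps / 2 / (Rabs m0 + 1)) <= eps / 2).
{ apply Rle_trans with ((Rabs m0 + 1) * (eps / 2 / (Rabs m0 + 1))).
  - apply Rmult_le_compat_r; lra.
  - right; field; lra. }
lra.
Qed.

(** Mean value theorem in the first variable along a path that is merely continuous: [m] is [fa] at
    a point between [p t] and [p s]. Not assuming [p] differentiable is what lets [implicit_derive]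
    use it. *)
Lemma partial_increment (f fa : R -> R -> R) (p : R -> R) (t : R) :
  locally_2d (fun a s => is_derive (fun b => f b s) a (fa a s)) (p t) t ->
  continuity_2d_pt fa (p t) t -> continuity_pt p t ->
  forall eps, 0 < eps -> exists d, 0 < d /\ forall s, Rabs (s - t) < d ->
    exists m, Rabs (m - fa (p t) t) < eps /\
      f (p s) s - f (p t) s = m * (p s - p t).
Proof.
intros [d1 H1] hc hp eps he.
destruct (hc (mkposreal eps he)) as [d2 H2]; simpl in H2.
set (d := Rmin d1 d2).
assert (hd : 0 < d) by (apply Rmin_glb_lt; apply cond_pos).
assert (hd1 : d <= d1) by apply Rmin_l.
assert (hd2 : d <= d2) by apply Rmin_r.
destruct (continuity_pt_eps _ _ hp d hd) as [d3 [hd3 H3]].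
exists (Rmin d d3); split; [now apply Rmin_glb_lt|].
intros s hs.
pose proof (Rmin_l d d3); pose proof (Rmin_r d d3).
specialize (H3 s ltac:(lra)).
assert (near : forall x, Rmin (p t) (p s) <= x <= Rmax (p t) (p s) ->
  Rabs (x - p t) < d).
{ intros x hx; revert H3; unfold Rmin, Rmax, Rabs in *.
  repeat (destruct Rle_dec || destruct Rcase_abs); lra. }
destruct (MVT_gen (fun b => f b s) (p t) (p s) (fun b => fa b s)) as [x [hx E]].
- intros x hx; apply H1; [specialize (near x ltac:(lra)); lra|lra].
- intros x hx; eapply is_derive_continuity_pt, H1;
    [specialize (near x ltac:(lra)); lra|lra].
- exists (fa x s); split; [|exact E].
  apply H2; [specialize (near x hx); lra|lra].
Qed.

Lemma chain_rule_2d (f fa : R -> R -> R) (p : R -> R) (t p' ft : R) :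
  locally_2d (fun a s => is_derive (fun b => f b s) a (fa a s)) (p t) t ->
  continuity_2d_pt fa (p t) t ->
  is_derive (fun s => f (p t) s) t ft -> is_derive p t p' ->
  is_derive (fun s => f (p s) s) t (fa (p t) t * p' + ft).
Proof.
intros hd hc ht hp.
apply (is_derive_ext (fun s => (f (p s) s - f (p t) s) + f (p t) s)).
{ intro s; change (f (p s) s - f (p t) s + f (p t) s = f (p s) s :> R); ring. }
apply (is_derive_plus (fun s => f (p s) s - f (p t) s)); [|exact ht].
apply (is_derive_factor _ p); [exact hp|].
intros eps he.
destruct (partial_increment _ _ _ _ hd hc (is_derive_continuity_pt _ _ _ hp) eps he)
  as [d [hd0 H]].
exists d; split; [exact hd0|]; intros s hs.
destruct (H s hs) as [m [hm E]]; exists m; split; [exact hm|].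
rewrite <- E; ring.
Qed.

(** By [partial_increment], the increment of [p] is [/ m] times that of [y s - f (p t) s], with
    [/ m] close to [/ fa (p t) t]; this is the situation of [is_derive_factor]. *)
Lemma implicit_derive (f fa : R -> R -> R) (p y : R -> R) (t y' ft d0 : R) :
  locally_2d (fun a s => is_derive (fun b => f b s) a (fa a s)) (p t) t ->
  continuity_2d_pt fa (p t) t -> 0 < fa (p t) t ->
  is_derive (fun s => f (p t) s) t ft -> is_derive y t y' ->
  continuity_pt p t ->
  0 < d0 -> (forall s, Rabs (s - t) < d0 -> f (p s) s = y s) ->
  is_derive p t (/ fa (p t) t * (y' - ft)).
Proof.
intros hd hc hpos ht hy hp hd0 heq.
apply (is_derive_factor _ (fun s => y s - f (p t) s)).
{ apply (is_derive_minus y (fun s => f (p t) s)); assumption. }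
intros eps he.
set (F := fa (p t) t) in *.
(* The first bound keeps m > F/2, so that m F > F^2/2; the second then makes |1/m - 1/F| = |F - m| /
   (m F) smaller than eps. *)
set (e1 := Rmin (F / 2) (eps * F * F / 4)).
assert (hF : 0 < eps * F * F) by (repeat apply Rmult_lt_0_compat; assumption).
assert (he1 : 0 < e1) by (apply Rmin_glb_lt; lra).
assert (he2 : e1 <= F / 2) by apply Rmin_l.
assert (he3 : e1 <= eps * F * F / 4) by apply Rmin_r.
destruct (partial_increment _ _ _ _ hd hc hp e1 he1) as [d [hd1 H]].
exists (Rmin d d0); split; [now apply Rmin_glb_lt|].
intros s hs; pose proof (Rmin_l d d0); pose proof (Rmin_r d d0).
destruct (H s ltac:(lra)) as [m [hm E]]; fold F in hm.
apply Rabs_def2 in hm.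
assert (hm0 : F / 2 < m) by lra.
exists (/ m); split.
- replace (/ m - / F) with ((F - m) * / (m * F)) by (field; lra).
  rewrite Rabs_mult, (Rabs_pos_eq (/ (m * F))).
  2: { left; apply Rinv_0_lt_compat, Rmult_lt_0_compat; lra. }
  assert (h1 : Rabs (F - m) <= eps * F * F / 4) by (apply Rabs_le; lra).
  assert (hmF : 0 < m * F) by (apply Rmult_lt_0_compat; lra).
  apply Rmult_lt_reg_r with (m * F); [exact hmF|].
  rewrite Rmult_assoc, Rinv_l, Rmult_1_r by lra.
  apply Rle_lt_trans with (1 := h1).
  assert (eps * F * (F / 2) < eps * F * m).
  { apply Rmult_lt_compat_l; [now apply Rmult_lt_0_compat|exact hm0]. }
  nra.
- rewrite <- (heq s), <- (heq t);
    [|rewrite Rminus_diag, Rabs_R0; exact hd0 | lra].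
  replace (f (p s) s - f (p t) s - (f (p t) t - f (p t) t))
    with (m * (p s - p t)) by lra.
  field; lra.
Qed.

(** The mean value theorem shows that [f s * exp (- K * s)] does not increase. The sign of [K] is
    free, which [gronwall_abs] exploits with [- (2 * K)]. *)
Lemma gronwall_le (f df : R -> R) (K t : R) :
  0 <= t -> (forall s, 0 <= s <= t -> continuity_pt f s) ->
  (forall s, 0 < s < t -> is_derive f s (df s)) ->
  (forall s, 0 < s < t -> df s <= K * f s) ->
  f t <= f 0 * exp (K * t).
Proof.
intros [ht|<-] hc hd hb.
2: { rewrite Rmult_0_r, exp_0; lra. }
destruct (mean_value_open (fun s => f s * exp (- K * s))
  (fun s => (df s - K * f s) * exp (- K * s)) 0 t ht) as [s [hs E]].
- intros s hs; apply continuity_pt_mult; [now apply hc|].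
  apply (is_derive_continuity_pt _ _ (- K * exp (- K * s))); auto_derive; [easy|ring].
- intros s hs.
  eapply is_derive_eq.
  + apply (is_derive_mult f (fun s => exp (- K * s)) s (df s) (- K * exp (- K * s))).
    * now apply hd.
    * auto_derive; [easy|ring].
    * intros; apply Rmult_comm.
  + unfold plus, mult; simpl; ring.
- rewrite Rmult_0_r, exp_0 in E.
  assert (h1 : (df s - K * f s) * exp (- K * s) * (t - 0) <= 0).
  { specialize (hb s hs); pose proof (exp_pos (- K * s)).
    assert ((df s - K * f s) * exp (- K * s) <= 0) by nra. nra. }
  assert (h2 : exp (- K * t) * exp (K * t) = 1).
  { rewrite <- exp_plus; replace (- K * t + K * t) with 0 by ring; apply exp_0. }
  pose proof (exp_pos (K * t)).
  replace (f t) with (f t * exp (- K * t) * exp (K * t)) by (rewrite Rmult_assoc, h2; ring).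
  apply Rmult_le_compat_r; lra.
Qed.

(** Squaring avoids differentiating the absolute value: the upper bound is [gronwall_le] for f^2,
    the lower one [gronwall_le] for -f^2. *)
Lemma gronwall_abs (f df : R -> R) (K t : R) :
  0 <= t -> (forall s, 0 <= s <= t -> continuity_pt f s) ->
  (forall s, 0 < s < t -> is_derive f s (df s)) ->
  (forall s, 0 < s < t -> Rabs (df s) <= K * Rabs (f s)) ->
  Rabs (f 0) * exp (- K * t) <= Rabs (f t) <= Rabs (f 0) * exp (K * t).
Proof.
intros ht hc hd hb.
assert (sq : forall s, 0 < s < t -> Rabs (f s * df s) <= K * (f s * f s)).
{ intros s hs; rewrite Rabs_mult.
  replace (K * (f s * f s)) with (Rabs (f s) * (K * Rabs (f s))).
  - apply Rmult_le_compat_l; [apply Rabs_pos|now apply hb].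
  - rewrite Rmult_comm, Rmult_assoc; f_equal.
    rewrite <- Rabs_mult, Rabs_pos_eq; [ring|nra]. }
assert (hc2 : forall s, 0 <= s <= t -> continuity_pt (fun s => f s * f s) s).
{ intros s hs; apply continuity_pt_mult; now apply hc. }
assert (hd2 : forall s, 0 < s < t -> is_derive (fun s => f s * f s) s (2 * (f s * df s))).
{ intros s hs; eapply is_derive_eq.
  - apply (is_derive_mult f f s (df s) (df s)); try now apply hd.
    intros; apply Rmult_comm.
  - unfold plus, mult; simpl; ring. }
assert (two : forall x, exp (2 * x) = exp x * exp x).
{ intro x; rewrite <- exp_plus; f_equal; ring. }
split; apply Rsqr_incr_0_var; try apply Rabs_pos;
  try (apply Rmult_le_pos; [apply Rabs_pos|left; apply exp_pos]);
  rewrite Rsqr_mult, <- !Rsqr_abs; unfold Rsqr.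
- pose proof (gronwall_le (fun s => - (f s * f s)) (fun s => - (2 * (f s * df s)))
    (- (2 * K)) t ht) as G.
  replace (- (2 * K) * t) with (2 * (- K * t)) in G by ring.
  rewrite two in G.
  enough (- (f t * f t) <= - (f 0 * f 0) * (exp (- K * t) * exp (- K * t))) by lra.
  apply G.
  + intros s hs; apply (continuity_pt_opp (fun s => f s * f s)); now apply hc2.
  + intros s hs; apply (is_derive_opp (fun s => f s * f s)); now apply hd2.
  + intros s hs; specialize (sq s hs); apply Rabs_le_between in sq; lra.
- pose proof (gronwall_le (fun s => f s * f s) (fun s => 2 * (f s * df s))
    (2 * K) t ht hc2 hd2) as G.
  replace (2 * K * t) with (2 * (K * t)) in G by ring.
  rewrite two in G; apply G.
  intros s hs; specialize (sq s hs); apply Rabs_le_between in sq; lra.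
Qed.

(** The lower bound of [gronwall_abs] forbids zeros, so the intermediate value theorem forbids a
    change of sign. It serves for the positivity of the density, the ordering of characteristics and
    the blow-up of u_x. *)
Lemma gronwall_pos (f df : R -> R) (K t : R) :
  0 <= t -> (forall s, 0 <= s <= t -> continuity_pt f s) ->
  (forall s, 0 < s < t -> is_derive f s (df s)) ->
  (forall s, 0 < s < t -> Rabs (df s) <= K * Rabs (f s)) ->
  0 < f 0 -> f 0 * exp (- K * t) <= f t.
Proof.
intros ht hc hd hb h0.
assert (nz : forall s, 0 <= s <= t -> f s <> 0).
{ intros s hs E.
  destruct (gronwall_abs f df K s) as [G _]; try easy.
  - intros; apply hc; lra.
  - intros; apply hd; lra.
  - intros; apply hb; lra.
  - rewrite E, Rabs_R0, Rabs_pos_eq in G by lra.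
    pose proof (Rmult_lt_0_compat _ _ h0 (exp_pos (- K * s))); lra. }
destruct (gronwall_abs f df K t ht hc hd hb) as [G _].
rewrite (Rabs_pos_eq (f 0)) in G by lra.
destruct (Rle_lt_dec 0 (f t)) as [p|n].
- now rewrite (Rabs_pos_eq (f t)) in G.
- exfalso; destruct ht as [ht|<-]; [|lra].
  destruct (Ranalysis5.IVT_interv (fun s => - f s) 0 t) as [z [hz E]]; try lra.
  + intros s hs; apply continuity_pt_opp; now apply hc.
  + apply (nz z hz); lra.
Qed.

(** The left edge is bounded by the one-variable theorem; the rectangle is then swept to the right
    in steps of d/2, over each of which uniform continuity lets [f] change by less than 1. *)
Lemma bounded_rectangle (f : R -> R -> R) (m M t : R) :
  0 <= t ->
  (forall x s, m <= x <= M -> 0 <= s <= t -> continuity_2d_pt f x s) ->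
  exists L, 0 <= L /\
    forall x s, m <= x <= M -> 0 <= s <= t -> Rabs (f x s) <= L.
Proof.
intros ht hc.
destruct (Rle_lt_dec m M) as [hm|hm].
2: { exists 0; split; [lra|]; intros; lra. }
destruct (uniform_continuity_2d f m M 0 t hc (mkposreal 1 Rlt_0_1)) as [d hd]; simpl in hd.
pose proof (cond_pos d) as hd0.
assert (H : forall n : nat, exists L, 0 <= L /\ forall x s, m <= x <= M ->
  x <= m + INR n * (d / 2) -> 0 <= s <= t -> Rabs (f x s) <= L).
{ induction n as [|n [L [hL IH]]].
  - assert (hcm : forall s, 0 <= s <= t -> continuity_pt (fun s => Rabs (f m s)) s).
    { intros s hs; apply (continuity_pt_comp (fun s => f m s)); [|apply Rcontinuity_abs].
      apply eps_continuity_pt; intros e he.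
      destruct (hc m s ltac:(lra) hs (mkposreal e he)) as [d' H'].
      exists d'; split; [apply cond_pos|]; intros y hy; apply H'; [|exact hy].
      rewrite Rminus_diag, Rabs_R0; apply cond_pos. }
    destruct (continuity_ab_maj (fun s => Rabs (f m s)) 0 t ht hcm) as [s0 [Hs _]].
    exists (Rabs (f m s0)); split; [apply Rabs_pos|].
    intros x s hx hx' hs; simpl in hx'.
    replace x with m by lra; now apply Hs.
  - exists (L + 1); split; [lra|].
    intros x s hx hx' hs; rewrite S_INR in hx'.
    (* One step back, stopped at the left edge. *)
    set (x' := Rmax m (x - d / 2)).
    assert (h1 : m <= x') by apply Rmax_l.
    assert (h2 : x - d / 2 <= x') by apply Rmax_r.
    assert (h3 : x' <= x) by (apply Rmax_lub; lra).
    assert (h4 : x' <= m + INR n * (d / 2)).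
    { apply Rmax_lub; [|lra]. pose proof (pos_INR n); nra. }
    specialize (IH x' s ltac:(lra) h4 hs).
    assert (Rabs (f x s - f x' s) < 1).
    { apply hd; try lra; [apply Rabs_def1; lra|rewrite Rminus_diag, Rabs_R0; lra]. }
    replace (f x s) with (f x' s + (f x s - f x' s)) by ring.
    eapply Rle_trans; [apply Rabs_triang|lra]. }
destruct (Rcomplements.nfloor_ex ((M - m) / (d / 2))) as [n hn].
{ apply Rmult_le_pos; [lra|left; apply Rinv_0_lt_compat; lra]. }
destruct (H (S n)) as [L [hL HL]]; exists L; split; [exact hL|].
intros x s hx hs; apply HL; [exact hx| |exact hs].
rewrite S_INR.
assert (M - m < (INR n + 1) * (d / 2)).
{ apply (Rmult_lt_reg_r (/ (d / 2))); [apply Rinv_0_lt_compat; lra|].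
  rewrite Rmult_assoc, Rinv_r, Rmult_1_r by lra; apply hn. }
lra.
Qed.

(** * The oscillator and integral curves *)

(* The solution of [y'' = w^2 (p / c - y)], [y 0 = 0], [y' 0 = q], and its
   first two derivatives. *)
Definition osc (c w p q t : R) : R :=
  p / c * (1 - cos (w * t)) + q / w * sin (w * t).
Definition dosc (c w p q t : R) : R :=
  p / c * w * sin (w * t) + q * cos (w * t).
Definition ddosc (c w p q t : R) : R :=
  p / c * (w * w) * cos (w * t) - q * w * sin (w * t).

Lemma osc_0 (c w p q : R) : osc c w p q 0 = 0.
Proof. unfold osc; rewrite Rmult_0_r, cos_0, sin_0; ring. Qed.

Lemma dosc_0 (c w p q : R) : dosc c w p q 0 = q.
Proof. unfold dosc; rewrite Rmult_0_r, cos_0, sin_0; ring. Qed.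

Lemma ddosc_osc (c w p q t : R) :
  w <> 0 -> ddosc c w p q t = w * w * (p / c - osc c w p q t).
Proof. intro hw; unfold ddosc, osc, Rdiv; generalize (/ c); intro; field; exact hw. Qed.

Lemma osc_derive (c w p q t : R) :
  w <> 0 -> is_derive (osc c w p q) t (dosc c w p q t).
Proof.
intro hw; unfold osc, dosc; auto_derive; [easy|].
unfold Rdiv; generalize (/ c); intro; field; exact hw.
Qed.

Lemma dosc_derive (c w p q t : R) :
  is_derive (dosc c w p q) t (ddosc c w p q t).
Proof. unfold dosc, ddosc; auto_derive; [easy|ring]. Qed.

(** [osc], [dosc] and [ddosc] are linear in the pair (p, q), so a derivative in the label only
    replaces these coefficients by their derivatives. *)
Lemma linear_derive (p q : R -> R) (a p' q' A B : R) :
  is_derive p a p' -> is_derive q a q' ->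
  is_derive (fun b => p b * A + q b * B) a (p' * A + q' * B).
Proof.
intros hp hq.
apply (is_derive_plus (fun b => p b * A) (fun b => q b * B));
  apply (is_derive_scal_l (V := R_NormedModule)); assumption.
Qed.

Lemma osc_derive_coeff (c w t : R) (p q : R -> R) (a p' q' : R) :
  is_derive p a p' -> is_derive q a q' ->
  is_derive (fun b => osc c w (p b) (q b) t) a (osc c w p' q' t).
Proof.
intros hp hq.
apply (is_derive_ext (fun b => p b * (/ c * (1 - cos (w * t))) + q b * (/ w * sin (w * t)))).
{ intro b; unfold osc, Rdiv; change (@eq R_NormedModule) with (@eq R); ring. }
eapply is_derive_eq; [apply linear_derive; eassumption|unfold osc, Rdiv; ring].
Qed.

Lemma dosc_derive_coeff (c w t : R) (p q : R -> R) (a p' q' : R) :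
  is_derive p a p' -> is_derive q a q' ->
  is_derive (fun b => dosc c w (p b) (q b) t) a (dosc c w p' q' t).
Proof.
intros hp hq.
apply (is_derive_ext (fun b => p b * (/ c * w * sin (w * t)) + q b * cos (w * t))).
{ intro b; unfold dosc, Rdiv; change (@eq R_NormedModule) with (@eq R); ring. }
eapply is_derive_eq; [apply linear_derive; eassumption|unfold dosc, Rdiv; ring].
Qed.

Lemma ddosc_derive_coeff (c w t : R) (p q : R -> R) (a p' q' : R) :
  is_derive p a p' -> is_derive q a q' ->
  is_derive (fun b => ddosc c w (p b) (q b) t) a (ddosc c w p' q' t).
Proof.
intros hp hq.
apply (is_derive_ext (fun b => p b * (/ c * (w * w) * cos (w * t)) + q b * (- w * sin (w * t)))).
{ intro b; unfold ddosc, Rdiv; change (@eq R_NormedModule) with (@eq R); ring. }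
eapply is_derive_eq; [apply linear_derive; eassumption|unfold ddosc, Rdiv; ring].
Qed.

Lemma linear_continuity_2d (p q : R -> R) (A B : R -> R) (a t : R) :
  continuous p a -> continuous q a ->
  continuous A t -> continuous B t ->
  continuity_2d_pt (fun a t => p a * A t + q a * B t) a t.
Proof.
intros hp hq hA hB; apply continuity_2d_pt_filterlim.
assert (h1 : forall f : R -> R, continuous f a ->
  continuous (fun z : R * R => f (fst z)) (a, t)).
{ intros f hf; apply (continuous_comp fst f); [apply continuous_fst|exact hf]. }
assert (h2 : forall f : R -> R, continuous f t ->
  continuous (fun z : R * R => f (snd z)) (a, t)).
{ intros f hf; apply (continuous_comp snd f); [apply continuous_snd|exact hf]. }
apply (continuous_plus (U := prod_UniformSpace R_UniformSpace R_UniformSpace)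
  (fun z : R * R => p (fst z) * A (snd z)) (fun z : R * R => q (fst z) * B (snd z)));
apply @continuous_mult; auto.
Qed.

Lemma osc_continuity_2d (c w : R) (p q : R -> R) (a t : R) :
  continuous p a -> continuous q a ->
  continuity_2d_pt (fun a t => osc c w (p a) (q a) t) a t.
Proof.
intros hp hq.
apply continuity_2d_pt_ext with (fun a t =>
  p a * (/ c * (1 - cos (w * t))) + q a * (/ w * sin (w * t))).
{ intros; unfold osc, Rdiv; ring. }
apply (linear_continuity_2d p q (fun t => / c * (1 - cos (w * t))) (fun t => / w * sin (w * t)));
  try assumption; apply (ex_derive_continuous (V := R_NormedModule)); auto_derive; easy.
Qed.

Lemma dosc_continuity_2d (c w : R) (p q : R -> R) (a t : R) :
  continuous p a -> continuous q a ->
  continuity_2d_pt (fun a t => dosc c w (p a) (q a) t) a t.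
Proof.
intros hp hq.
apply continuity_2d_pt_ext with (fun a t =>
  p a * (/ c * w * sin (w * t)) + q a * cos (w * t)).
{ intros; unfold dosc, Rdiv; ring. }
apply (linear_continuity_2d p q (fun t => / c * w * sin (w * t)) (fun t => cos (w * t)));
  try assumption; apply (ex_derive_continuous (V := R_NormedModule)); auto_derive; easy.
Qed.

Lemma ddosc_continuity_2d (c w : R) (p q : R -> R) (a t : R) :
  continuous p a -> continuous q a ->
  continuity_2d_pt (fun a t => ddosc c w (p a) (q a) t) a t.
Proof.
intros hp hq.
apply continuity_2d_pt_ext with (fun a t =>
  p a * (/ c * (w * w) * cos (w * t)) + q a * (- w * sin (w * t))).
{ intros; unfold ddosc, Rdiv; ring. }
apply (linear_continuity_2d p q (fun t => / c * (w * w) * cos (w * t)) (fun t => - w * sin (w * t)));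
  try assumption; apply (ex_derive_continuous (V := R_NormedModule)); auto_derive; easy.
Qed.

(** What the comparison of neighbours uses of a solution on a compact time interval. Continuity is
    two-sided even at t = 0, because the record is instantiated with functions frozen at negative
    times by [Rmax 0 s]. The mass equation is kept apart, as a hypothesis on the one characteristic
    where it is used. *)
Record smooth_flow (k c : R) (rho u ux E : R -> R -> R) (T : R) : Prop := {
  sf_rho : forall x t, 0 <= t <= T -> continuity_2d_pt rho x t;
  sf_u : forall x t, 0 <= t <= T -> continuity_2d_pt u x t;
  sf_ux : forall x t, 0 <= t <= T -> continuity_2d_pt ux x t;
  sf_u_x : forall x t, 0 <= t <= T -> is_derive (fun y => u y t) x (ux x t);
  sf_u_t : forall x t, 0 < t < T ->
    is_derive (fun s => u x s) t (k * E x t - u x t * ux x t);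
  sf_E_x : forall x t, 0 <= t <= T -> is_derive (fun y => E y t) x (rho x t - c)
}.

Definition curve (u : R -> R -> R) (T a : R) (X : R -> R) : Prop :=
  X 0 = a /\ (forall t, 0 <= t <= T -> continuity_pt X t) /\
  (forall t, 0 < t < T -> is_derive X t (u (X t) t)).

Lemma continuity_along (f : R -> R -> R) (X : R -> R) (t : R) :
  continuity_2d_pt f (X t) t -> continuity_pt X t ->
  continuity_pt (fun s => f (X s) s) t.
Proof.
intros hf hX; apply eps_continuity_pt; intros eps he.
destruct (hf (mkposreal eps he)) as [d Hd]; simpl in Hd.
destruct (continuity_pt_eps _ _ hX d (cond_pos d)) as [d' [hd' Hd']].
exists (Rmin d d'); split; [apply Rmin_glb_lt; [apply cond_pos|exact hd']|].
intros s hs; pose proof (Rmin_l d d'); pose proof (Rmin_r d d').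
apply Hd; [apply Hd'|]; lra.
Qed.

Lemma derive_mean_value (f df : R -> R) (x y : R) :
  (forall z, Rmin x y <= z <= Rmax x y -> is_derive f z (df z)) ->
  exists z, Rmin x y <= z <= Rmax x y /\ f y - f x = df z * (y - x).
Proof.
intro H; apply MVT_gen.
- intros z hz; apply H; lra.
- intros z hz; eapply is_derive_continuity_pt, H, hz.
Qed.

(** The chain rule along X turns u_t + u u_x into a total derivative, so characteristics are twice
    differentiable in time although u_x need not be differentiable. *)
Lemma momentum_along (k c : R) (rho u ux E : R -> R -> R) (T a : R) (X : R -> R) :
  smooth_flow k c rho u ux E T -> curve u T a X ->
  forall t, 0 < t < T -> is_derive (fun s => u (X s) s) t (k * E (X t) t).
Proof.
intros S [_ [_ hX]] t ht.
eapply is_derive_eq.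
- apply (chain_rule_2d u ux).
  + assert (hd : 0 < Rmin t (T - t)) by (apply Rmin_glb_lt; lra).
    exists (mkposreal _ hd); simpl; intros y s _ hs.
    apply (sf_u_x _ _ _ _ _ _ _ S).
    pose proof (Rmin_l t (T - t)); pose proof (Rmin_r t (T - t)).
    apply Rabs_def2 in hs; lra.
  + apply (sf_ux _ _ _ _ _ _ _ S); lra.
  + apply (sf_u_t _ _ _ _ _ _ _ S), ht.
  + apply hX, ht.
- simpl; ring.
Qed.

(** The difference of the velocities is [ux] at an intermediate point times [Y s - X s], so both
    conclusions are Gronwall bounds for the gap: from above, and from below with its sign. *)
Lemma curve_gap (u ux : R -> R -> R) (T m M L a b : R) (X Y : R -> R) :
  curve u T a X -> curve u T b Y ->
  (forall t, 0 <= t <= T -> m <= X t <= M) ->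
  (forall t, 0 <= t <= T -> m <= Y t <= M) ->
  (forall x t, m <= x <= M -> 0 <= t <= T -> Rabs (ux x t) <= L) ->
  (forall x t, 0 <= t <= T -> is_derive (fun y => u y t) x (ux x t)) ->
  forall t, 0 <= t <= T ->
    Rabs (Y t - X t) <= Rabs (b - a) * exp (L * t) /\
    (a < b -> X t < Y t).
Proof.
intros [X0 [cX dX]] [Y0 [cY dY]] hX hY hL hu t ht.
assert (c1 : forall s, 0 <= s <= t -> continuity_pt (fun s => Y s - X s) s).
{ intros; apply continuity_pt_minus; [apply cY|apply cX]; lra. }
assert (d1 : forall s, 0 < s < t ->
  is_derive (fun s => Y s - X s) s (u (Y s) s - u (X s) s)).
{ intros; apply (is_derive_minus Y X); [apply dY|apply dX]; lra. }
assert (b1 : forall s, 0 < s < t ->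
  Rabs (u (Y s) s - u (X s) s) <= L * Rabs (Y s - X s)).
{ intros s hs.
  destruct (derive_mean_value (fun y => u y s) (fun y => ux y s) (X s) (Y s)) as [z [hz ->]].
  - intros; apply hu; lra.
  - rewrite Rabs_mult; apply Rmult_le_compat_r; [apply Rabs_pos|].
    specialize (hX s ltac:(lra)); specialize (hY s ltac:(lra)).
    apply hL; [|lra].
    revert hz; unfold Rmin, Rmax; destruct Rle_dec; lra. }
split.
- pose proof (proj2 (gronwall_abs _ _ L t (proj1 ht) c1 d1 b1)) as G.
  cbv beta in G; now rewrite X0, Y0 in G.
- intro hab; pose proof (gronwall_pos _ _ L t (proj1 ht) c1 d1 b1) as G.
  cbv beta in G; rewrite X0, Y0 in G; specialize (G ltac:(lra)).
  pose proof (exp_pos (- L * t)); nra.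
Qed.

Lemma curve_bounds (u : R -> R -> R) (T a : R) (X : R -> R) :
  0 <= T -> curve u T a X ->
  exists m M, forall t, 0 <= t <= T -> m <= X t <= M.
Proof.
intros hT [_ [cX _]].
destruct (continuity_ab_maj X 0 T hT cX) as [tM [HM _]].
destruct (continuity_ab_min X 0 T hT cX) as [tm [Hm _]].
exists (X tm), (X tM); intros; split; [apply Hm|apply HM]; assumption.
Qed.

(** On a compact time interval both curves stay in a rectangle, where [ux] is bounded and
    [curve_gap] applies. *)
Lemma curve_unique_monotone (u ux : R -> R -> R) (T a b : R) (X Y : R -> R) :
  curve u T a X -> curve u T b Y ->
  (forall x t, 0 <= t <= T -> continuity_2d_pt ux x t) ->
  (forall x t, 0 <= t <= T -> is_derive (fun y => u y t) x (ux x t)) ->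
  forall t, 0 <= t <= T ->
    (a = b -> X t = Y t) /\ (a < b -> X t < Y t).
Proof.
intros hX hY hc hu t ht.
destruct (curve_bounds u T a X ltac:(lra) hX) as [m1 [M1 H1]].
destruct (curve_bounds u T b Y ltac:(lra) hY) as [m2 [M2 H2]].
set (m := Rmin m1 m2); set (M := Rmax M1 M2).
pose proof (Rmin_l m1 m2); pose proof (Rmin_r m1 m2).
pose proof (Rmax_l M1 M2); pose proof (Rmax_r M1 M2).
destruct (bounded_rectangle ux m M T) as [L [hL HL]]; [lra|intros; now apply hc|].
destruct (curve_gap u ux T m M L a b X Y hX hY) with (t := t) as [G1 G2]; auto.
- intros s hs; specialize (H1 s hs); unfold m, M; lra.
- intros s hs; specialize (H2 s hs); unfold m, M; lra.
- split; [|exact G2].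
  intros <-; rewrite Rminus_diag, Rabs_R0, Rmult_0_l in G1.
  pose proof (Rabs_pos (Y t - X t)).
  assert (E : Rabs (Y t - X t) = 0) by lra.
  destruct (Req_dec (Y t - X t) 0) as [|n]; [lra|].
  now apply Rabs_no_R0 in n.
Qed.

(** * Difference quotients of neighbouring characteristics *)

Lemma exp_le (x y : R) : x <= y -> exp x <= exp y.
Proof. intros [h| ->]; [left; now apply exp_increasing|right; easy]. Qed.

Lemma exp_ge_1 (x : R) : 0 <= x -> 1 <= exp x.
Proof. intro h; rewrite <- exp_0; now apply exp_le. Qed.

(* Duhamel: [v sin (w (T - s)) + w y cos (w (T - s))] has derivative
   [f sin (w (T - s))]. *)
Lemma duhamel_estimate (w T eps : R) (y v f : R -> R) :
  0 < w -> 0 < T ->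
  (forall s, 0 <= s <= T -> continuity_pt y s) ->
  (forall s, 0 <= s <= T -> continuity_pt v s) ->
  (forall s, 0 < s < T -> is_derive y s (v s)) ->
  (forall s, 0 < s < T -> is_derive v s (f s - w * w * y s)) ->
  (forall s, 0 < s < T -> Rabs (f s) <= eps) ->
  y 0 = 0 ->
  w * Rabs (y T) <= Rabs (v 0) + eps * T.
Proof.
intros hw hT cy cv dy dv hf y0.
assert (sin_bound : forall x, Rabs (sin x) <= 1).
{ intro x; apply Rabs_le; pose proof (SIN_bound x); lra. }
destruct (mean_value_open
  (fun s => v s * sin (w * (T - s)) + w * (y s * cos (w * (T - s))))
  (fun s => f s * sin (w * (T - s))) 0 T hT) as [s [hs E]].
- intros s hs; apply continuity_pt_plus.
  + apply continuity_pt_mult; [now apply cv|].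
    eapply is_derive_continuity_pt; auto_derive; [easy|reflexivity].
  + apply (continuity_pt_scal (fun s => y s * cos (w * (T - s)))).
    apply continuity_pt_mult; [now apply cy|].
    eapply is_derive_continuity_pt; auto_derive; [easy|reflexivity].
- intros s hs.
  eapply is_derive_eq.
  + apply (is_derive_plus (fun s => v s * sin (w * (T - s)))
      (fun s => w * (y s * cos (w * (T - s))))).
    * apply (is_derive_mult v (fun s => sin (w * (T - s))) s (f s - w * w * y s) (- w * cos (w * (T - s)))).
      -- now apply dv.
      -- auto_derive; [easy|unfold Rminus; ring].
      -- intros; apply Rmult_comm.
    * apply (is_derive_scal (fun s => y s * cos (w * (T - s)))).
      apply (is_derive_mult y (fun s => cos (w * (T - s))) s (v s) (w * sin (w * (T - s)))).
      -- now apply dy.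
      -- auto_derive; [easy|unfold Rminus; ring].
      -- intros; apply Rmult_comm.
  + unfold plus, mult, scal; simpl; unfold mult; simpl; ring.
- rewrite Rminus_diag, Rmult_0_r, sin_0, cos_0, Rminus_0_r, y0 in E.
  (* Duhamel's formula with the integral replaced by [T] times the integrand at a mean point [s]. *)
  assert (E' : w * y T = v 0 * sin (w * T) + f s * sin (w * (T - s)) * T) by lra.
  rewrite <- (Rabs_pos_eq w) at 1 by lra.
  rewrite <- Rabs_mult, E'.
  eapply Rle_trans; [apply Rabs_triang|].
  rewrite !Rabs_mult, (Rabs_pos_eq T) by lra.
  specialize (hf s hs).
  pose proof (sin_bound (w * T)); pose proof (sin_bound (w * (T - s))).
  pose proof (Rabs_pos (v 0)); pose proof (Rabs_pos (f s)).
  pose proof (Rabs_pos (sin (w * T))); pose proof (Rabs_pos (sin (w * (T - s)))).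
  apply Rplus_le_compat; [nra|].
  apply Rmult_le_compat_r; [lra|]. nra.
Qed.

(** Let D be the difference quotient, r the density along X and z = D r. The mass equation gives z'
    = (ux(x) - ux(X)) z for some x between X and Y, hence z is nearly rho0. Then D'' = k (rho(x) -
    c) D is k (rho0 - c D) up to a small forcing, and Duhamel compares D with the exact oscillator.
    [K] is fixed before [eps], so both bounds pass to the limit h -> 0. *)
Lemma neighbour_estimate (k c w T a u0' : R) (rho u ux E : R -> R -> R)
    (Xf : R -> R -> R) :
  0 < k -> 0 < c -> 0 < w -> w * w = k * c -> 0 < T ->
  smooth_flow k c rho u ux E T ->
  (forall b, curve u T b (Xf b)) ->
  is_derive (fun x => u x 0) a u0' ->
  (forall t, 0 < t < T -> is_derive (fun s => rho (Xf a s) s) t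
     (- (rho (Xf a t) t * ux (Xf a t) t))) ->
  0 < rho a 0 ->
  0 < rho (Xf a T) T /\
  exists K, 0 <= K /\ forall eps, 0 < eps <= 1 -> exists d, 0 < d /\
    forall h, h <> 0 -> Rabs h < d ->
      Rabs ((Xf (a + h) T - Xf a T) / h -
            (1 + osc c w (rho a 0 - c) u0' T)) <= K * eps /\
      Rabs ((Xf (a + h) T - Xf a T) / h * rho (Xf a T) T - rho a 0) <= K * eps.
Proof.
intros hk hc hw hwkc hT S hXf hu0 hmass hrho.
(* The curves issued from a - 1 and a + 1 enclose all those with labels in between, so one rectangle
   and one bound [L] serve every |h| < 1. *)
destruct (curve_bounds u T _ _ ltac:(lra) (hXf (a - 1))) as [m [M1 B1]].
destruct (curve_bounds u T _ _ ltac:(lra) (hXf (a + 1))) as [m1 [M B2]].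
assert (hbox : forall b t, a - 1 < b < a + 1 -> 0 <= t <= T -> m <= Xf b t <= M).
{ intros b t hb ht; specialize (B1 t ht); specialize (B2 t ht).
  pose proof (sf_ux _ _ _ _ _ _ _ S) as s1; pose proof (sf_u_x _ _ _ _ _ _ _ S) as s2.
  pose proof (proj2 (curve_unique_monotone u ux T _ _ _ _ (hXf (a - 1)) (hXf b) s1 s2 t ht) ltac:(lra)).
  pose proof (proj2 (curve_unique_monotone u ux T _ _ _ _ (hXf b) (hXf (a + 1)) s1 s2 t ht) ltac:(lra)).
  lra. }
destruct (bounded_rectangle ux m M T) as [L [hL HL]].
{ lra. } { intros; now apply (sf_ux _ _ _ _ _ _ _ S). }
set (X := Xf a).
destruct (hXf a) as [X0 [cX dX]]; fold X in X0, cX, dX, hmass |- *.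
assert (hXbox : forall t, 0 <= t <= T -> m <= X t <= M).
{ intros; apply hbox; lra. }
set (r := fun s => rho (X s) s).
assert (cr : forall s, 0 <= s <= T -> continuity_pt r s).
{ intros s hs; apply continuity_along; [now apply (sf_rho _ _ _ _ _ _ _ S)|now apply cX]. }
assert (r0 : r 0 = rho a 0) by (unfold r; now rewrite X0).
assert (hrT : 0 < r T).
{ pose proof (gronwall_pos r (fun t => - (rho (X t) t * ux (X t) t)) L T ltac:(lra) cr hmass) as G.
  rewrite r0 in G.
  assert (0 < rho a 0 * exp (- L * T)) by (apply Rmult_lt_0_compat; [lra|apply exp_pos]).
  enough (rho a 0 * exp (- L * T) <= r T) by lra.
  apply G; [|lra].
  intros s hs; rewrite Rabs_Ropp, Rabs_mult, Rmult_comm; fold (r s).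
  apply Rmult_le_compat_r; [apply Rabs_pos|].
  apply HL; [apply hXbox|]; lra. }
split; [exact hrT|].
(* [exp (L * T)] bounds D, and [rho a 0 * (exp T * T)] bounds the drift of z per unit of [eps]
   ([exp T] dominates [exp (eps * q)] since eps <= 1). The forcing is thus at most [k * K1 * eps];
   in (1 + k K1 T) / w the 1 accounts for the initial velocity. *)
set (K1 := exp (L * T) + rho a 0 * (exp T * T)).
assert (hLT : 1 <= exp (L * T)) by (apply exp_ge_1; nra).
assert (heT : 1 <= exp T) by (apply exp_ge_1; lra).
assert (hK3 : 0 <= rho a 0 * (exp T * T)) by (repeat apply Rmult_le_pos; lra).
assert (hK1 : 0 <= K1).
{ unfold K1; lra. }
assert (hK2 : 0 <= (1 + k * K1 * T) / w).
{ apply Rmult_le_pos; [|left; apply Rinv_0_lt_compat, hw].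
  assert (0 <= k * K1 * T) by (repeat apply Rmult_le_pos; lra). lra. }
exists ((1 + k * K1 * T) / w + rho a 0 * (exp T * T)); split; [lra|].
intros eps [he he1].
destruct (uniform_continuity_2d ux m M 0 T) with (eps := mkposreal eps he) as [d1 Hd1].
{ intros; now apply (sf_ux _ _ _ _ _ _ _ S). }
destruct (uniform_continuity_2d rho m M 0 T) with (eps := mkposreal eps he) as [d2 Hd2].
{ intros; now apply (sf_rho _ _ _ _ _ _ _ S). }
simpl in Hd1, Hd2.
destruct (eps_is_derive _ _ _ hu0 eps he) as [d3 [hd3 Hd3]].
(* The gap is at most |h| exp(L T), so |h| < [d4] keeps both curves within the moduli of continuity
   of [ux] and [rho]. *)
set (d4 := Rmin d1 d2 / exp (L * T)).
assert (hd12 : 0 < Rmin d1 d2) by (apply Rmin_glb_lt; apply cond_pos).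
assert (hd4 : 0 < d4) by (apply Rdiv_lt_0_compat; lra).
exists (Rmin 1 (Rmin d3 d4)); split; [repeat apply Rmin_glb_lt; lra|].
intros h hh hd.
pose proof (Rmin_l 1 (Rmin d3 d4)); pose proof (Rmin_r 1 (Rmin d3 d4)).
pose proof (Rmin_l d3 d4); pose proof (Rmin_r d3 d4).
pose proof (Rmin_l d1 d2); pose proof (Rmin_r d1 d2).
assert (hab : a - 1 < a + h < a + 1).
{ assert (Rabs h < 1) as G by lra; apply Rabs_def2 in G; lra. }
set (Y := Xf (a + h)).
destruct (hXf (a + h)) as [Y0 [cY dY]]; fold Y in Y0, cY, dY |- *.
assert (hYbox : forall t, 0 <= t <= T -> m <= Y t <= M).
{ intros; apply hbox; lra. }
assert (hgap : forall t, 0 <= t <= T -> Rabs (Y t - X t) <= Rabs h * exp (L * T)).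
{ intros t ht.
  destruct (curve_gap u ux T m M L a (a + h) X Y (hXf a) (hXf (a + h))
    hXbox hYbox HL (sf_u_x _ _ _ _ _ _ _ S) t ht) as [G _].
  replace (a + h - a) with h in G by ring.
  eapply Rle_trans; [exact G|]; apply Rmult_le_compat_l; [apply Rabs_pos|].
  apply exp_le; nra. }
assert (hclose : forall t, 0 <= t <= T -> Rabs (Y t - X t) < Rmin d1 d2).
{ intros t ht; eapply Rle_lt_trans; [now apply hgap|].
  apply (Rmult_lt_reg_r (/ exp (L * T))); [apply Rinv_0_lt_compat; lra|].
  rewrite Rmult_assoc, Rinv_r, Rmult_1_r by lra; fold (Rmin d1 d2 / exp (L * T)).
  fold d4; lra. }
assert (hbetween : forall t z, 0 <= t <= T ->
  Rmin (X t) (Y t) <= z <= Rmax (X t) (Y t) ->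
  m <= z <= M /\ Rabs (z - X t) < Rmin d1 d2).
{ intros t z ht hz; specialize (hXbox t ht); specialize (hYbox t ht).
  specialize (hclose t ht); apply Rabs_def2 in hclose.
  revert hz; unfold Rmin at 1, Rmax; destruct Rle_dec; intro hz.
  all: split; [lra|apply Rabs_def1; lra]. }
set (D := fun s => (Y s - X s) / h).
set (V := fun s => (u (Y s) s - u (X s) s) / h).
assert (cD : forall s, 0 <= s <= T -> continuity_pt D s).
{ intros s hs; apply (continuity_pt_ext (fun s => / h * (Y s - X s))).
  - intro; unfold D, Rdiv; ring.
  - apply (continuity_pt_scal (fun s => Y s - X s)).
    apply continuity_pt_minus; [now apply cY|now apply cX]. }
assert (cV : forall s, 0 <= s <= T -> continuity_pt V s).
{ intros s hs; apply (continuity_pt_ext (fun s => / h * (u (Y s) s - u (X s) s))).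
  - intro; unfold V, Rdiv; ring.
  - apply (continuity_pt_scal (fun s => u (Y s) s - u (X s) s)).
    apply continuity_pt_minus; apply continuity_along;
      try (now apply (sf_u _ _ _ _ _ _ _ S)); [now apply cY|now apply cX]. }
assert (scale : forall (f : R -> R) s l, is_derive f s l ->
  is_derive (fun s => f s / h) s (l / h)).
{ intros f s l Hf; apply (is_derive_ext (fun s => / h * f s)).
  - intro; apply Rmult_comm.
  - eapply is_derive_eq; [apply (is_derive_scal f); exact Hf|apply Rmult_comm]. }
assert (dD : forall s, 0 < s < T -> is_derive D s (V s)).
{ intros s hs; apply (scale (fun s => Y s - X s)).
  apply (is_derive_minus Y X); [now apply dY|now apply dX]. }
assert (dV : forall s, 0 < s < T ->
  is_derive V s (k * (E (Y s) s - E (X s) s) / h)).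
{ intros s hs; eapply is_derive_eq.
  - apply (scale (fun s => u (Y s) s - u (X s) s)).
    apply (is_derive_minus (fun s => u (Y s) s) (fun s => u (X s) s)).
    + exact (momentum_along _ _ _ _ _ _ _ _ _ S (hXf (a + h)) s hs).
    + exact (momentum_along _ _ _ _ _ _ _ _ _ S (hXf a) s hs).
  - unfold minus, plus, opp; simpl; unfold X, Y, Rdiv; ring. }
assert (D0 : D 0 = 1).
{ unfold D; rewrite X0, Y0; field; exact hh. }
assert (hDb : forall s, 0 <= s <= T -> Rabs (D s) <= exp (L * T)).
{ intros s hs; unfold D, Rdiv; rewrite Rabs_mult, Rabs_inv.
  apply (Rmult_le_reg_r (Rabs h)); [now apply Rabs_pos_lt|].
  rewrite Rmult_assoc, Rinv_l, Rmult_1_r, (Rmult_comm (exp _)) by now apply Rabs_no_R0.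
  now apply hgap. }
set (z := fun s => D s * r s).
assert (cz : forall s, 0 <= s <= T -> continuity_pt z s).
{ intros s hs; apply continuity_pt_mult; [now apply cD|now apply cr]. }
assert (z0 : z 0 = rho a 0) by (unfold z; rewrite D0, r0; ring).
assert (dz : forall s, 0 < s < T ->
  is_derive z s (V s * r s - D s * (r s * ux (X s) s))).
{ intros s hs; eapply is_derive_eq.
  - apply (is_derive_mult D r s (V s) (- (rho (X s) s * ux (X s) s))).
    + now apply dD.
    + now apply hmass.
    + intros; apply Rmult_comm.
  - unfold plus, mult; simpl; unfold r; ring. }
(* The mass equation cancels [ux (X s) s] against the growth rate of D; only the variation of [ux]
   between the two curves survives. *)
assert (bz : forall s, 0 < s < T ->
  Rabs (V s * r s - D s * (r s * ux (X s) s)) <= eps * Rabs (z s)).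
{ intros s hs.
  destruct (derive_mean_value (fun y => u y s) (fun y => ux y s) (X s) (Y s)) as [x [hx Ex]].
  { intros; apply (sf_u_x _ _ _ _ _ _ _ S); lra. }
  destruct (hbetween s x ltac:(lra) hx) as [G1 G2].
  replace (V s * r s - D s * (r s * ux (X s) s)) with ((ux x s - ux (X s) s) * z s).
  - rewrite Rabs_mult; apply Rmult_le_compat_r; [apply Rabs_pos|]; left.
    specialize (hXbox s ltac:(lra)).
    apply Hd1; try lra. rewrite Rminus_diag, Rabs_R0; apply cond_pos.
  - unfold z, V, D; rewrite Ex; unfold Rdiv; ring. }
assert (hz : forall s, 0 <= s <= T -> Rabs (z s - rho a 0) <= rho a 0 * (exp T * T) * eps).
{ intros s [[hs|<-] hsT].
  2: { rewrite z0, Rminus_diag, Rabs_R0; nra. }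
  destruct (mean_value_open z _ 0 s hs
    ltac:(intros; apply cz; lra) ltac:(intros; apply dz; lra)) as [q [hq Eq]].
  rewrite <- z0, Eq, Rabs_mult, (Rabs_pos_eq (s - 0)) by lra.
  destruct (gronwall_abs z _ eps q ltac:(lra)
    ltac:(intros; apply cz; lra) ltac:(intros; apply dz; lra)
    ltac:(intros; apply bz; lra)) as [_ G].
  rewrite z0, (Rabs_pos_eq (rho a 0)) in G by lra.
  specialize (bz q ltac:(lra)).
  assert (G2 : exp (eps * q) <= exp T) by (apply exp_le; nra).
  rewrite z0.
  apply Rle_trans with ((eps * (rho a 0 * exp T)) * T); [|right; ring].
  apply Rmult_le_compat; [apply Rabs_pos|lra| |lra].
  eapply Rle_trans; [exact bz|]; apply Rmult_le_compat_l; [lra|].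
  eapply Rle_trans; [exact G|]; apply Rmult_le_compat_l; lra. }
set (J := fun s => 1 + osc c w (rho a 0 - c) u0' s).
assert (dJ : forall s, is_derive J s (dosc c w (rho a 0 - c) u0' s)).
{ intro s; eapply is_derive_eq.
  - apply (is_derive_plus (fun _ => 1)); [apply is_derive_const|].
    apply osc_derive; lra.
  - apply Rplus_0_l. }
(* Since J'' = k (rho0 - c J), the difference D - J is an oscillator of frequency w, zero at time 0,
   forced by k ((E(Y) - E(X))/h + c D - rho0). By E_x = rho - c this forcing is k ((rho(x) - rho(X))
   D + (z - rho0)). *)
assert (est : w * Rabs (D T - J T) <= Rabs (V 0 - u0') + k * K1 * eps * T).
{ pose proof (duhamel_estimate w T (k * K1 * eps)
    (fun s => D s - J s) (fun s => V s - dosc c w (rho a 0 - c) u0' s)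
    (fun s => k * ((E (Y s) s - E (X s) s) / h + c * D s - rho a 0)) hw hT) as G.
  cbv beta in G; rewrite dosc_0 in G; apply G; clear G.
  - intros s hs; apply continuity_pt_minus; [now apply cD|].
    exact (is_derive_continuity_pt _ _ _ (dJ s)).
  - intros s hs; apply continuity_pt_minus; [now apply cV|].
    exact (is_derive_continuity_pt _ _ _ (dosc_derive _ _ _ _ s)).
  - intros s hs; apply (is_derive_minus D J); [now apply dD|apply dJ].
  - intros s hs; eapply is_derive_eq.
    + apply (is_derive_minus V (dosc c w (rho a 0 - c) u0')); [now apply dV|apply dosc_derive].
    + unfold minus, plus, opp; simpl.
      rewrite ddosc_osc, hwkc by lra; unfold J; field; lra.
  - intros s hs.
    destruct (derive_mean_value (fun y => E y s) (fun y => rho y s - c) (X s) (Y s)) as [x [hx Ex]].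
    { intros; apply (sf_E_x _ _ _ _ _ _ _ S); lra. }
    destruct (hbetween s x ltac:(lra) hx) as [G1 G2].
    replace (k * ((E (Y s) s - E (X s) s) / h + c * D s - rho a 0))
      with (k * ((rho x s - rho (X s) s) * D s + (z s - rho a 0))).
    2: { rewrite Ex; unfold z, r, D; field; exact hh. }
    rewrite Rabs_mult, (Rabs_pos_eq k), Rmult_assoc by lra.
    apply Rmult_le_compat_l; [lra|].
    eapply Rle_trans; [apply Rabs_triang|]; rewrite Rabs_mult.
    specialize (hz s ltac:(lra)); specialize (hDb s ltac:(lra)).
    assert (G3 : Rabs (rho x s - rho (X s) s) <= eps).
    { left; specialize (hXbox s ltac:(lra)).
      apply Hd2; try lra. rewrite Rminus_diag, Rabs_R0; apply cond_pos. }
    assert (Rabs (rho x s - rho (X s) s) * Rabs (D s) <= eps * exp (L * T)).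
    { apply Rmult_le_compat; try apply Rabs_pos; assumption. }
    unfold K1; lra.
  - unfold J; rewrite D0, osc_0; ring. }
assert (hV0 : Rabs (V 0 - u0') <= eps).
{ left; unfold V; rewrite X0, Y0; apply Hd3; lra. }
fold (D T); fold (r T); fold (J T); split.
- apply Rle_trans with ((1 + k * K1 * T) / w * eps).
  + apply (Rmult_le_reg_l w); [exact hw|].
    replace (w * ((1 + k * K1 * T) / w * eps)) with (eps + k * K1 * eps * T) by (field; lra).
    lra.
  + apply Rmult_le_compat_r; lra.
- fold (z T); specialize (hz T ltac:(lra)).
  eapply Rle_trans; [exact hz|]; apply Rmult_le_compat_r; lra.
Qed.

(** The two estimates share the quotient D: the first gives its limit, and eliminating D between
    them leaves the identity rho G = rho0. *)
Lemma curve_derivative_label (k c w T a u0' : R) (rho u ux E : R -> R -> R)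
    (Xf : R -> R -> R) :
  0 < k -> 0 < c -> 0 < w -> w * w = k * c -> 0 < T ->
  smooth_flow k c rho u ux E T ->
  (forall b, curve u T b (Xf b)) ->
  is_derive (fun x => u x 0) a u0' ->
  (forall t, 0 < t < T -> is_derive (fun s => rho (Xf a s) s) t
     (- (rho (Xf a t) t * ux (Xf a t) t))) ->
  0 < rho a 0 ->
  0 < rho (Xf a T) T /\
  is_derive (fun b => Xf b T) a (1 + osc c w (rho a 0 - c) u0' T) /\
  rho (Xf a T) T * (1 + osc c w (rho a 0 - c) u0' T) = rho a 0.
Proof.
intros hk hc hw hwkc hT S hXf hu0 hmass hrho.
destruct (neighbour_estimate k c w T a u0' rho u ux E Xf) as [hr [K [hK H]]]; try assumption.
split; [exact hr|].
set (r := rho (Xf a T) T) in *; set (J := 1 + osc c w (rho a 0 - c) u0' T) in *.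
split.
- apply is_derive_eps; intros eps he.
  set (e := Rmin 1 (eps / 2 / (K + 1))).
  assert (0 < eps / 2 / (K + 1)) by (apply Rdiv_lt_0_compat; lra).
  assert (he0 : 0 < e) by (apply Rmin_glb_lt; lra).
  assert (he1 : e <= 1) by apply Rmin_l.
  destruct (H e) as [d [hd Hd]]; [lra|].
  exists d; split; [exact hd|]; intros h hh hhd.
  destruct (Hd h hh hhd) as [G _].
  eapply Rle_lt_trans; [exact G|].
  apply Rle_lt_trans with ((K + 1) * (eps / 2 / (K + 1))).
  + apply Rmult_le_compat; try lra. apply Rmin_r.
  + replace ((K + 1) * (eps / 2 / (K + 1))) with (eps / 2) by (field; lra); lra.
- apply Rminus_diag_uniq.
  destruct (Req_dec (r * J - rho a 0) 0) as [|n]; [easy|exfalso].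
  apply Rabs_pos_lt in n; set (x := Rabs (r * J - rho a 0)) in *.
  (* [C] exceeds K r + K, so [e <= x / 2 / C] contradicts x <= K e r + K e. *)
  set (C := (K * r + K + 1)).
  assert (hC : 0 < C) by (unfold C; nra).
  set (e := Rmin 1 (x / 2 / C)).
  assert (0 < x / 2 / C) by (apply Rdiv_lt_0_compat; lra).
  assert (he0 : 0 < e) by (apply Rmin_glb_lt; lra).
  assert (he1 : e <= 1) by apply Rmin_l.
  assert (he2 : e <= x / 2 / C) by apply Rmin_r.
  destruct (H e) as [d [hd Hd]]; [lra|].
  destruct (Hd (d / 2)) as [G1 G2]; [lra|rewrite Rabs_pos_eq; lra|].
  set (D := (Xf (a + d / 2) T - Xf a T) / (d / 2)) in *.
  assert (x <= K * e * r + K * e).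
  { unfold x; replace (r * J - rho a 0) with (- (D - J) * r + (D * r - rho a 0)) by ring.
    eapply Rle_trans; [apply Rabs_triang|].
    rewrite Rabs_mult, Rabs_Ropp, (Rabs_pos_eq r) by lra.
    apply Rplus_le_compat; [|exact G2].
    apply Rmult_le_compat_r; lra. }
  assert (C * e <= x / 2).
  { apply Rle_trans with (C * (x / 2 / C)).
    - apply Rmult_le_compat_l; lra.
    - right; field; lra. }
  unfold C in *; nra.
Qed.

(** * Characteristics of an arbitrary solution *)

(** [flow] and [jac] are the X and G of the overview. With the coefficients (e a, u0 a), [dosc] is
    the velocity and [ddosc] is k E along the characteristic. *)
Definition flow (c w : R) (e u0 : R -> R) (a t : R) : R :=
  a + osc c w (e a) (u0 a) t.
Definition jac (c w : R) (rho0 u0 : R -> R) (a t : R) : R :=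
  1 + osc c w (rho0 a - c) (Derive u0 a) t.

Lemma Rbar_lt_near (T : Rbar) (t : R) :
  Rbar_lt t T -> exists d, 0 < d /\ forall s, Rabs (s - t) < d -> Rbar_lt s T.
Proof.
intro h; destruct (open_Rbar_lt T t h) as [d hd].
exists d; split; [apply cond_pos|]; intros s hs; apply hd, hs.
Qed.

Lemma Rbar_lt_le_trans_R (T : Rbar) (s t : R) :
  s <= t -> Rbar_lt t T -> Rbar_lt s T.
Proof. intros h1 h2; now apply (Rbar_le_lt_trans s t T). Qed.

Lemma C0_strip_eps (T : Rbar) (f : R -> R -> R) :
  C0_strip T f ->
  forall x t, 0 <= t -> Rbar_lt t T -> forall eps, 0 < eps ->
  exists d, 0 < d /\ forall y s, Rabs (y - x) < d -> Rabs (s - t) < d ->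
    0 <= s -> Rbar_lt s T -> Rabs (f y s - f x t) < eps.
Proof.
intros H x t h0 hT eps he.
specialize (H (x, t) (conj h0 hT) _ (locally_ball (f x t) (mkposreal eps he))).
destruct H as [d Hd].
exists d; split; [apply cond_pos|]; intros y s hy hs h0' hT'.
apply (Hd (y, s)); [split; assumption|split; assumption].
Qed.

Lemma eps_C0_strip (T : Rbar) (f : R -> R -> R) :
  (forall x t, 0 <= t -> Rbar_lt t T -> forall eps, 0 < eps ->
  exists d, 0 < d /\ forall y s, Rabs (y - x) < d -> Rabs (s - t) < d ->
    0 <= s -> Rbar_lt s T -> Rabs (f y s - f x t) < eps) ->
  C0_strip T f.
Proof.
intros H [x t] [h0 hT]; simpl in h0, hT.
apply filterlim_locally; intro eps.
destruct (H x t h0 hT eps (cond_pos eps)) as [d [hd Hd]].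
exists (mkposreal d hd); intros [y s] [hy hs] [h0' hT'].
apply Hd; assumption.
Qed.

(** Freezing the function at times before 0 turns the one-sided continuity of the strip at t = 0
    into the two-sided notion used by the calculus lemmas. *)
Lemma C0_strip_extend (T : Rbar) (f : R -> R -> R) (x t : R) :
  C0_strip T f -> 0 <= t -> Rbar_lt t T ->
  continuity_2d_pt (fun x s => f x (Rmax 0 s)) x t.
Proof.
intros H h0 hT eps.
destruct (C0_strip_eps T f H x t h0 hT eps (cond_pos eps)) as [d [hd Hd]].
destruct (Rbar_lt_near T t hT) as [d' [hd' HT]].
assert (hm : 0 < Rmin d d') by now apply Rmin_glb_lt.
exists (mkposreal _ hm); simpl; intros y s hy hs.
pose proof (Rmin_l d d'); pose proof (Rmin_r d d').
assert (hs' : Rabs (Rmax 0 s - t) < Rmin d d').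
{ revert hs; unfold Rmax, Rabs.
  repeat (destruct Rle_dec || destruct Rcase_abs); lra. }
rewrite (Rmax_right 0 t) by exact h0.
apply Hd; [lra|lra|apply Rmax_l|apply HT; lra].
Qed.

Lemma is_derive_extend (f : R -> R) (t l : R) :
  0 < t -> is_derive f t l -> is_derive (fun s => f (Rmax 0 s)) t l.
Proof.
intros ht; apply (is_derive_local f _ t l t ht).
intros y hy; apply Rabs_def2 in hy; rewrite Rmax_right; [easy|lra].
Qed.

Lemma characteristic_curve (T : Rbar) (u : R -> R -> R) (a t : R) (X : R -> R) :
  Rbar_lt t T -> characteristic T u a X ->
  curve (fun x s => u x (Rmax 0 s)) t a (fun s => X (Rmax 0 s)).
Proof.
intros hT [X0 [cX dX]]; split; [|split].
- now rewrite Rmax_left by lra.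
- intros s hs; apply eps_continuity_pt; intros eps he.
  assert (hsT : Rbar_lt s T) by (apply (Rbar_lt_le_trans_R T s t); [lra|easy]).
  destruct (cX s (conj (proj1 hs) hsT) _ (locally_ball (X s) (mkposreal eps he)))
    as [d Hd].
  destruct (Rbar_lt_near T s hsT) as [d' [hd' HT]].
  exists (Rmin d d'); split; [apply Rmin_glb_lt; [apply cond_pos|exact hd']|].
  intros y hy; rewrite (Rmax_right 0 s) by apply hs.
  pose proof (Rmin_l d d'); pose proof (Rmin_r d d').
  assert (hy' : Rabs (Rmax 0 y - s) < Rmin d d').
  { revert hy; unfold Rmax, Rabs.
    repeat (destruct Rle_dec || destruct Rcase_abs); lra. }
  apply (Hd (Rmax 0 y)).
  + change (Rabs (Rmax 0 y - s) < d); lra.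
  + split; [apply Rmax_l|apply HT; lra].
- intros s hs; rewrite (Rmax_right 0 s) by lra.
  apply is_derive_extend; [lra|].
  apply dX; [lra|apply (Rbar_lt_le_trans_R T s t); [lra|easy]].
Qed.

Lemma C1_strip_dx (T : Rbar) (u : R -> R -> R) :
  C1_strip T u ->
  (forall x t, 0 <= t -> Rbar_lt t T -> is_derive (fun y => u y t) x (dx u x t)) /\
  (forall x t, 0 < t -> Rbar_lt t T -> is_derive (fun s => u x s) t (dt u x t)) /\
  C0_strip T (dx u).
Proof.
intros [_ [fx [ft [cx [_ [hx ht]]]]]]; split; [|split].
- intros x t h0 hT; apply Derive_correct; exists (fx x t); auto.
- intros x t h0 hT; apply Derive_correct; exists (ft x t); auto.
- unfold C0_strip; apply continuous_on_ext with (2 := cx).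
  intros [x t] [h0 hT]; simpl in *; symmetry; apply is_derive_unique; auto.
Qed.

Lemma solution_smooth_flow (k c : R) (rho0 u0 : R -> R) (T : Rbar)
    (rho u E : R -> R -> R) (t : R) :
  solution k c rho0 u0 T rho u E -> Rbar_lt t T ->
  smooth_flow k c (fun x s => rho x (Rmax 0 s)) (fun x s => u x (Rmax 0 s))
    (fun x s => dx u x (Rmax 0 s)) (fun x s => E x (Rmax 0 s)) t.
Proof.
intros S hT.
destruct (C1_strip_dx T u (sol_u_C1 _ _ _ _ _ _ _ _ S)) as [hx [ht cx]].
assert (le : forall s, s <= t -> Rbar_lt s T).
{ intros; now apply (Rbar_lt_le_trans_R T s t). }
split.
- intros x s hs; apply (C0_strip_extend T rho); [apply S|apply hs|apply le, hs].
- intros x s hs; apply (C0_strip_extend T u); [apply S|apply hs|apply le, hs].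
- intros x s hs; apply (C0_strip_extend T (dx u)); [easy|apply hs|apply le, hs].
- intros x s hs; rewrite (Rmax_right 0 s) by apply hs; apply hx; [apply hs|apply le, hs].
- intros x s hs; rewrite (Rmax_right 0 s) by lra.
  apply (is_derive_extend (u x)); [lra|].
  eapply is_derive_eq; [apply ht; [lra|apply le; lra]|].
  rewrite <- (sol_momentum _ _ _ _ _ _ _ _ S) by (try apply le; lra); ring.
- intros x s hs; rewrite (Rmax_right 0 s) by apply hs.
  apply (sol_poisson _ _ _ _ _ _ _ _ S); [apply hs|apply le, hs].
Qed.

Lemma characteristic_unique (T : Rbar) (u : R -> R -> R) (a : R) (X Y : R -> R) :
  C1_strip T u -> characteristic T u a X -> characteristic T u a Y ->
  forall t, 0 <= t -> Rbar_lt t T -> X t = Y t.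
Proof.
intros hu hX hY t ht hT.
destruct (C1_strip_dx T u hu) as [hx [_ cx]].
pose proof (characteristic_curve T u a t X hT hX) as hX'.
pose proof (characteristic_curve T u a t Y hT hY) as hY'.
pose proof (curve_unique_monotone _ (fun x s => dx u x (Rmax 0 s)) t a a _ _ hX' hY') as G.
assert (le : forall s, s <= t -> Rbar_lt s T).
{ intros; now apply (Rbar_lt_le_trans_R T s t). }
assert (G' := fun h1 h2 => proj1 (G h1 h2 t (conj ht (Rle_refl t))) eq_refl).
cbv beta in G'; rewrite (Rmax_right 0 t) in G' by exact ht.
apply G'.
- intros x s hs; apply (C0_strip_extend T (dx u)); [easy|apply hs|apply le, hs].
- intros x s hs; rewrite (Rmax_right 0 s) by apply hs; apply hx; [apply hs|apply le, hs].
Qed.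

Lemma is_derive_const_diff (f g df : R -> R) :
  (forall x, is_derive f x (df x)) -> (forall x, is_derive g x (df x)) ->
  forall x y, f x - g x = f y - g y.
Proof.
intros hf hg x y.
destruct (derive_mean_value (fun z => f z - g z) (fun _ => 0) x y) as [z [_ H]].
- intros z _; eapply is_derive_eq.
  + apply (is_derive_minus f g); [apply hf|apply hg].
  + apply Rminus_diag.
- lra.
Qed.

(** The data in oscillator form: [e] is the initial field E, and its vanishing at both ends encodes
    neutrality. *)
Record flow_data (k c w : R) (rho0 u0 e : R -> R) : Prop := {
  fd_k : 0 < k;
  fd_c : 0 < c;
  fd_w : 0 < w;
  fd_wkc : w * w = k * c;
  fd_rho0_pos : forall a, 0 < rho0 a;
  fd_rho0 : forall a, continuous rho0 a;
  fd_u0 : forall a, is_derive u0 a (Derive u0 a);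
  fd_du0 : forall a, continuous (Derive u0) a;
  fd_e : forall a, is_derive e a (rho0 a - c);
  fd_e_lim : forall x, x = m_infty \/ x = p_infty -> is_lim e x 0;
  fd_u0_lim : forall x, x = m_infty \/ x = p_infty -> is_lim u0 x 0;
  fd_rho0_lim : forall x, x = m_infty \/ x = p_infty -> is_lim rho0 x c;
  fd_du0_lim : forall x, x = m_infty \/ x = p_infty -> is_lim (Derive u0) x 0
}.

(** A whole family of characteristics is taken as given, since a derivative in the label involves
    the neighbours of [a]. Time 0 is separate because the comparison needs an interval of positive
    length. *)
Lemma family_label_derivative (k c w : R) (rho0 u0 e : R -> R) (T : Rbar)
    (rho u E : R -> R -> R) (Xf : R -> R -> R) :
  flow_data k c w rho0 u0 e -> solution k c rho0 u0 T rho u E ->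
  (forall b, characteristic T u b (Xf b)) ->
  forall a t, 0 <= t -> Rbar_lt t T ->
  0 < rho (Xf a t) t /\
  is_derive (fun b => Xf b t) a (jac c w rho0 u0 a t) /\
  rho (Xf a t) t * jac c w rho0 u0 a t = rho0 a.
Proof.
intros [hk hc hw hwkc hrho0 _ hu0 _ _ _ _ _ _] S hXf a t [ht|<-] hT.
- pose proof (curve_derivative_label k c w t a (Derive u0 a) _ _ _ _
    (fun b s => Xf b (Rmax 0 s)) hk hc hw hwkc ht
    (solution_smooth_flow k c rho0 u0 T rho u E t S hT)
    (fun b => characteristic_curve T u b t (Xf b) hT (hXf b))) as G.
  cbv beta in G.
  rewrite (Rmax_right 0 t), (Rmax_left 0 0) in G by lra.
  rewrite (sol_rho_init _ _ _ _ _ _ _ _ S) in G.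
  apply G; [| |apply hrho0].
  + apply (is_derive_ext u0); [|apply hu0].
    intro x; symmetry; apply (sol_u_init _ _ _ _ _ _ _ _ S).
  + intros s hs; rewrite (Rmax_right 0 s) by lra.
    apply (is_derive_extend (fun s => rho (Xf a s) s)); [lra|].
    apply (sol_mass _ _ _ _ _ _ _ _ S a (Xf a) (hXf a)); [lra|].
    apply (Rbar_lt_le_trans_R T s t); [lra|easy].
- assert (X0 : forall b, Xf b 0 = b) by (intro b; apply (hXf b)).
  unfold jac; rewrite osc_0, X0, (sol_rho_init _ _ _ _ _ _ _ _ S).
  split; [apply hrho0|split; [|ring]].
  apply (is_derive_ext (fun b => b)); [intro b; now rewrite X0|].
  eapply is_derive_eq; [apply is_derive_id|unfold one; simpl; ring].
Qed.

Lemma flow_derive_label (k c w : R) (rho0 u0 e : R -> R) (a t : R) :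
  flow_data k c w rho0 u0 e ->
  is_derive (fun b => flow c w e u0 b t) a (jac c w rho0 u0 a t).
Proof.
intro F.
apply (is_derive_plus (fun b => b) (fun b => osc c w (e b) (u0 b) t));
  [exact (is_derive_id (K := R_AbsRing) a)|].
apply osc_derive_coeff; apply F.
Qed.

Lemma osc_lim_0 (c w t : R) (p q : R -> R) (x : Rbar) :
  is_lim p x 0 -> is_lim q x 0 -> is_lim (fun b => osc c w (p b) (q b) t) x 0.
Proof.
intros hp hq.
apply (is_lim_ext (fun b => p b * (/ c * (1 - cos (w * t))) + q b * (/ w * sin (w * t)))).
{ intro; unfold osc, Rdiv; ring. }
replace (Finite 0) with (Finite (0 * (/ c * (1 - cos (w * t))) + 0 * (/ w * sin (w * t))))
  by (f_equal; ring).
apply is_lim_plus'; [exact (is_lim_scal_r p _ x 0 hp)|exact (is_lim_scal_r q _ x 0 hq)].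
Qed.

Lemma dosc_lim_0 (c w t : R) (p q : R -> R) (x : Rbar) :
  is_lim p x 0 -> is_lim q x 0 -> is_lim (fun b => dosc c w (p b) (q b) t) x 0.
Proof.
intros hp hq.
apply (is_lim_ext (fun b => p b * (/ c * w * sin (w * t)) + q b * cos (w * t))).
{ intro; unfold dosc, Rdiv; ring. }
replace (Finite 0) with (Finite (0 * (/ c * w * sin (w * t)) + 0 * cos (w * t)))
  by (f_equal; ring).
apply is_lim_plus'; [exact (is_lim_scal_r p _ x 0 hp)|exact (is_lim_scal_r q _ x 0 hq)].
Qed.

Lemma ddosc_lim_0 (c w t : R) (p q : R -> R) (x : Rbar) :
  is_lim p x 0 -> is_lim q x 0 -> is_lim (fun b => ddosc c w (p b) (q b) t) x 0.
Proof.
intros hp hq.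
apply (is_lim_ext (fun b => p b * (/ c * (w * w) * cos (w * t)) + q b * (- w * sin (w * t)))).
{ intro; unfold ddosc, Rdiv; ring. }
replace (Finite 0) with (Finite (0 * (/ c * (w * w) * cos (w * t)) + 0 * (- w * sin (w * t))))
  by (f_equal; ring).
apply is_lim_plus'; [exact (is_lim_scal_r p _ x 0 hp)|exact (is_lim_scal_r q _ x 0 hq)].
Qed.

Lemma flow_0 (c w : R) (e u0 : R -> R) (a : R) : flow c w e u0 a 0 = a.
Proof. unfold flow; rewrite osc_0; ring. Qed.

Lemma flow_derive_time (c w : R) (e u0 : R -> R) (a t : R) :
  w <> 0 -> is_derive (fun s => flow c w e u0 a s) t (dosc c w (e a) (u0 a) t).
Proof.
intro hw; eapply is_derive_eq.
- apply (is_derive_plus (fun _ => a)); [apply is_derive_const|now apply osc_derive].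
- apply Rplus_0_l.
Qed.

Lemma is_lim_shift_infty (f : R -> R) (x : Rbar) (l : R) :
  x = m_infty \/ x = p_infty -> is_lim f x l -> is_lim (fun b => b + f b) x x.
Proof.
intros hx hf; apply (is_lim_plus _ _ x x l); [apply is_lim_id|exact hf|].
now destruct hx as [-> | ->].
Qed.

(* [family_label_derivative] determines the characteristics up to a translation
   [C t]; comparing velocities as the label goes to -oo shows [C' = 0]. *)
Lemma characteristic_flow (k c w : R) (rho0 u0 e : R -> R) (T : Rbar)
    (rho u E : R -> R -> R) (Xf : R -> R -> R) :
  flow_data k c w rho0 u0 e -> solution k c rho0 u0 T rho u E ->
  (forall b, characteristic T u b (Xf b)) ->
  forall a t, 0 <= t -> Rbar_lt t T -> Xf a t = flow c w e u0 a t.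
Proof.
intros F S hXf a t ht hT.
set (C := fun s => Xf 0 s - flow c w e u0 0 s).
assert (hC : forall b s, 0 <= s -> Rbar_lt s T -> Xf b s = flow c w e u0 b s + C s).
{ intros b s hs hsT.
  pose proof (is_derive_const_diff (fun b => Xf b s) (fun b => flow c w e u0 b s)
    (fun b => jac c w rho0 u0 b s)
    (fun b => proj1 (proj2 (family_label_derivative _ _ _ _ _ _ _ _ _ _ _ F S hXf b s hs hsT)))
    (fun b => flow_derive_label _ _ _ _ _ _ b s F) b 0) as G.
  unfold C; cbv beta in G; lra. }
assert (hw : w <> 0) by (pose proof (fd_w _ _ _ _ _ _ F); lra).
assert (dC : forall s, 0 < s -> Rbar_lt s T -> is_derive C s 0).
{ intros s hs hsT.
  assert (dCb : forall b, is_derive C s (u (Xf b s) s - dosc c w (e b) (u0 b) s)).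
  { intro b; destruct (Rbar_lt_near T s hsT) as [d [hd Hd]].
    apply (is_derive_local (fun s => Xf b s - flow c w e u0 b s) _ s _ (Rmin d s)).
    - now apply Rmin_glb_lt.
    - intros y hy; pose proof (Rmin_l d s); pose proof (Rmin_r d s).
      rewrite (hC b y); [ring| |apply Hd; lra].
      apply Rabs_def2 in hy; lra.
    - apply (is_derive_minus (Xf b) (fun s => flow c w e u0 b s)).
      + now apply (hXf b).
      + now apply flow_derive_time. }
  eapply is_derive_eq; [exact (dCb 0)|].
  set (l := u (Xf 0 s) s - dosc c w (e 0) (u0 0) s).
  assert (El : forall b, l = u (Xf b s) s - dosc c w (e b) (u0 b) s).
  { intro b; rewrite <- (is_derive_unique _ _ _ (dCb b)); symmetry.
    apply is_derive_unique, dCb. }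
  assert (L1 : is_lim (fun _ => l) m_infty 0).
  { apply (is_lim_ext (fun b => u (Xf b s) s - dosc c w (e b) (u0 b) s)).
    { intro; now rewrite <- El. }
    replace (Finite 0) with (Finite (0 - 0)) by (f_equal; ring).
    apply (is_lim_minus' (fun b => u (Xf b s) s)).
    2: { apply dosc_lim_0; apply F; now left. }
    apply (is_lim_comp (fun x => u x s) (fun b => Xf b s) m_infty 0 m_infty).
    - apply (sol_u_far _ _ _ _ _ _ _ _ S); [lra|exact hsT].
    - apply (is_lim_ext (fun b => b + (osc c w (e b) (u0 b) s + C s))).
      { intro b; rewrite hC by (try lra; easy); unfold flow; ring. }
      apply (is_lim_shift_infty _ _ (0 + C s)); [now left|].
      apply (is_lim_plus' (fun b => osc c w (e b) (u0 b) s));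
        [|apply is_lim_const].
      apply osc_lim_0; apply F; now left.
    - exists 0; intros; discriminate. }
  apply is_lim_unique in L1; rewrite Lim_const in L1; now injection L1. }
rewrite hC by easy; enough (C t = 0) by lra.
assert (C0 : C 0 = 0).
{ unfold C; rewrite flow_0, (proj1 (hXf 0)); ring. }
destruct ht as [ht|<-]; [|exact C0].
destruct (characteristic_curve T u 0 t (Xf 0) hT (hXf 0)) as [_ [cX _]].
(* [C] is controlled only for s >= 0, hence the composition with [Rmax 0]. *)
destruct (mean_value_open (fun s => C (Rmax 0 s)) (fun _ => 0) 0 t ht) as [s [_ G]].
- intros s hs.
  apply (continuity_pt_minus (fun s => Xf 0 (Rmax 0 s)) (fun s => flow c w e u0 0 (Rmax 0 s))).
  + now apply cX.
  + apply (continuity_pt_comp (Rmax 0) (fun s => flow c w e u0 0 s)).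
    * apply eps_continuity_pt; intros eps he; exists eps; split; [exact he|].
      intros y; unfold Rmax, Rabs; repeat (destruct Rle_dec || destruct Rcase_abs); lra.
    * eapply is_derive_continuity_pt; now apply flow_derive_time.
- intros s hs; apply is_derive_extend; [lra|]; apply dC; [lra|].
  apply (Rbar_lt_le_trans_R T s t); [lra|easy].
- rewrite (Rmax_left 0 0), (Rmax_right 0 t) in G by lra; lra.
Qed.

(** As [rho] stays positive and [rho * jac = rho0], the Jacobian is positive as long as a solution
    exists. Both the necessity of the threshold and the breakdown rest on this. *)
Lemma solution_along_characteristic (k c w : R) (rho0 u0 e : R -> R) (T : Rbar)
    (rho u E : R -> R -> R) :
  flow_data k c w rho0 u0 e -> solution k c rho0 u0 T rho u E ->
  forall a X, characteristic T u a X -> forall t, 0 <= t -> Rbar_lt t T ->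
  X t = flow c w e u0 a t /\
  0 < jac c w rho0 u0 a t /\
  rho (X t) t = rho0 a / jac c w rho0 u0 a t.
Proof.
intros F S a X hX t ht hT.
(* One characteristic is chosen for every label; uniqueness then identifies the given [X] with the
   chosen one. *)
assert (H : exists Xf, forall b, characteristic T u b (Xf b)).
{ exists (fun b => epsilon (inhabits (fun _ => 0)) (characteristic T u b)).
  intro b; apply epsilon_spec, (sol_characteristics _ _ _ _ _ _ _ _ S). }
destruct H as [Xf hXf].
rewrite (characteristic_unique T u a X (Xf a) (sol_u_C1 _ _ _ _ _ _ _ _ S) hX (hXf a) t ht hT).
split; [exact (characteristic_flow _ _ _ _ _ _ _ _ _ _ _ F S hXf a t ht hT)|].
destruct (family_label_derivative _ _ _ _ _ _ _ _ _ _ _ F S hXf a t ht hT) as [G1 [_ G2]].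
pose proof (fd_rho0_pos _ _ _ _ _ _ F a).
assert (0 < jac c w rho0 u0 a t).
{ apply (Rmult_lt_reg_l (rho (Xf a t) t)); lra. }
split; [easy|]; rewrite <- G2; field; lra.
Qed.

Lemma jac_derive_time (c w : R) (rho0 u0 : R -> R) (a t : R) :
  w <> 0 ->
  is_derive (fun s => jac c w rho0 u0 a s) t (dosc c w (rho0 a - c) (Derive u0 a) t).
Proof.
intro hw; eapply is_derive_eq.
- apply (is_derive_plus (fun _ => 1)); [apply is_derive_const|now apply osc_derive].
- apply Rplus_0_l.
Qed.

(** The derivative of the density along X is known twice, from rho0 / G and from the mass equation;
    dividing by rho > 0 isolates u_x. *)
Lemma solution_gradient (k c w : R) (rho0 u0 e : R -> R) (T : Rbar)
    (rho u E : R -> R -> R) :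
  flow_data k c w rho0 u0 e -> solution k c rho0 u0 T rho u E ->
  forall a X, characteristic T u a X -> forall t, 0 < t -> Rbar_lt t T ->
  dx u (X t) t = dosc c w (rho0 a - c) (Derive u0 a) t / jac c w rho0 u0 a t.
Proof.
intros F S a X hX t ht hT.
assert (hw : w <> 0) by (pose proof (fd_w _ _ _ _ _ _ F); lra).
pose proof (solution_along_characteristic _ _ _ _ _ _ _ _ _ _ F S a X hX) as H.
destruct (H t ltac:(lra) hT) as [_ [hJ hr]].
pose proof (fd_rho0_pos _ _ _ _ _ _ F a) as hp.
assert (d1 : is_derive (fun s => rho (X s) s) t
  (rho0 a * (- dosc c w (rho0 a - c) (Derive u0 a) t / jac c w rho0 u0 a t ^ 2))).
{ destruct (Rbar_lt_near T t hT) as [d [hd Hd]].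
  apply (is_derive_local (fun s => rho0 a * / jac c w rho0 u0 a s) _ t _ (Rmin d t)).
  - now apply Rmin_glb_lt.
  - intros y hy; pose proof (Rmin_l d t); pose proof (Rmin_r d t).
    symmetry; apply H; [apply Rabs_def2 in hy; lra|apply Hd; lra].
  - apply (is_derive_scal (fun s => / jac c w rho0 u0 a s)).
    apply (is_derive_inv (fun s => jac c w rho0 u0 a s)); [now apply jac_derive_time|lra]. }
pose proof (sol_mass _ _ _ _ _ _ _ _ S a X hX t ht hT) as d2.
apply is_derive_unique in d1; apply is_derive_unique in d2.
rewrite d1, hr in d2; clear d1.
apply (Rmult_eq_reg_l (- (rho0 a / jac c w rho0 u0 a t))).
- transitivity (- (rho0 a / jac c w rho0 u0 a t * dx u (X t) t)); [ring|].
  rewrite <- d2; field; lra.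
- apply Ropp_neq_0_compat; unfold Rdiv.
  apply Rgt_not_eq, Rmult_lt_0_compat; [lra|now apply Rinv_0_lt_compat].
Qed.

(** * Threshold, oscillation and breakdown *)

(** Isolates the mean rho0/c of G from its sinusoidal part. Positivity of G compares this mean with
    the amplitude, and where G > 0 the density is below c exactly when G exceeds its mean. *)
Lemma jac_amplitude (c w : R) (rho0 u0 : R -> R) (a t : R) :
  0 < c ->
  jac c w rho0 u0 a t = rho0 a / c -
    ((rho0 a / c - 1) * cos (w * t) - Derive u0 a / w * sin (w * t)).
Proof.
intro hc; unfold jac, osc; replace ((rho0 a - c) / c) with (rho0 a / c - 1) by (field; lra).
ring.
Qed.

(** Divided by k c, subcriticality reads B^2 < 1 + 2 A, that is A^2 + B^2 < (1 + A)^2: the amplitude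
    is smaller than the mean. *)
Lemma subcritical_jac_pos (k c w : R) (rho0 u0 e : R -> R) :
  flow_data k c w rho0 u0 e -> subcritical k c rho0 u0 ->
  forall a t, 0 < jac c w rho0 u0 a t.
Proof.
intros F H a t; destruct (H a) as [h1 h2].
pose proof (fd_k _ _ _ _ _ _ F) as hk; pose proof (fd_c _ _ _ _ _ _ F) as hc.
pose proof (fd_w _ _ _ _ _ _ F) as hw; pose proof (fd_wkc _ _ _ _ _ _ F) as hwkc.
pose proof (fd_rho0_pos _ _ _ _ _ _ F a) as hr.
rewrite jac_amplitude by exact hc.
set (A := rho0 a / c - 1); set (B := Derive u0 a / w).
set (g := A * cos (w * t) - B * sin (w * t)).
assert (hq : Derive u0 a * Derive u0 a < k * (2 * rho0 a - c)).
{ apply sqrt_lt_0_alt; rewrite <- (sqrt_Rsqr_abs (Derive u0 a)) in h2; exact h2. }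
assert (hB : B * B < 1 + 2 * A).
{ replace (B * B) with (Derive u0 a * Derive u0 a / (k * c)).
  - replace (1 + 2 * A) with (k * (2 * rho0 a - c) / (k * c)) by (unfold A; field; lra).
    apply Rmult_lt_compat_r; [apply Rinv_0_lt_compat; nra|exact hq].
  - unfold B; rewrite <- hwkc; field; lra. }
assert (hg : g * g <= A * A + B * B).
{ pose proof (sin2_cos2 (w * t)) as hsc; unfold Rsqr in hsc.
  assert (A * A + B * B - g * g = (A * sin (w * t) + B * cos (w * t)) ^ 2).
  { replace (A * A + B * B) with
      ((A * A + B * B) * (sin (w * t) * sin (w * t) + cos (w * t) * cos (w * t)))
      by (rewrite hsc; ring).
    unfold g; ring. }
  pose proof (pow2_ge_0 (A * sin (w * t) + B * cos (w * t))); lra. }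
assert (h1A : 0 < 1 + A).
{ unfold A; assert (0 < rho0 a / c) by now apply Rdiv_lt_0_compat. lra. }
replace (rho0 a / c) with (1 + A) by (unfold A; ring).
nra.
Qed.

(** Positivity is tested at the two phases where the sinusoid equals plus and minus its amplitude;
    this returns A^2 + B^2 < (1 + A)^2. *)
Lemma jac_pos_subcritical (k c w : R) (rho0 u0 e : R -> R) :
  flow_data k c w rho0 u0 e ->
  (forall a t, 0 <= t -> 0 < jac c w rho0 u0 a t) -> subcritical k c rho0 u0.
Proof.
intros F H a.
pose proof (fd_k _ _ _ _ _ _ F) as hk; pose proof (fd_c _ _ _ _ _ _ F) as hc.
pose proof (fd_w _ _ _ _ _ _ F) as hw; pose proof (fd_wkc _ _ _ _ _ _ F) as hwkc.
pose proof (fd_rho0_pos _ _ _ _ _ _ F a) as hr.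
set (A := rho0 a / c - 1); set (B := Derive u0 a / w).
assert (HH : forall x, 0 <= x -> A * cos x - B * sin x < 1 + A).
{ intros x hx; specialize (H a (x / w)).
  rewrite jac_amplitude in H by exact hc.
  replace (w * (x / w)) with x in H by (field; lra).
  specialize (H ltac:(apply Rmult_le_pos; [lra|left; now apply Rinv_0_lt_compat])).
  unfold A, B; lra. }
(* A critical phase: this function takes the values B and -B at 0 and PI. Where it vanishes, g^2 is
   the full A^2 + B^2, and x + PI gives the opposite sign, still at a nonnegative time. *)
destruct (IVT_gen (fun x => A * sin x + B * cos x) 0 PI 0) as [x [hx E]].
- intro x; eapply is_derive_continuity_pt; auto_derive; [easy|reflexivity].
- rewrite sin_0, cos_0, sin_PI, cos_PI.
  unfold Rmin, Rmax; repeat destruct Rle_dec; lra.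
- pose proof PI_RGT_0 as hpi; rewrite Rmin_left, Rmax_right in hx by lra.
  set (g := A * cos x - B * sin x).
  assert (hg : g * g = A * A + B * B).
  { pose proof (sin2_cos2 x) as hsc; unfold Rsqr in hsc.
    transitivity ((A * A + B * B) * (sin x * sin x + cos x * cos x) -
      (A * sin x + B * cos x) * (A * sin x + B * cos x)); [unfold g; ring|].
    rewrite hsc, E; ring. }
  assert (h1 : g < 1 + A) by (apply HH; lra).
  assert (h2 : - g < 1 + A).
  { replace (- g) with (A * cos (x + PI) - B * sin (x + PI)); [apply HH; lra|].
    rewrite neg_cos, neg_sin; unfold g; ring. }
  assert (hB : B * B < 1 + 2 * A) by nra.
  assert (hq : Derive u0 a * Derive u0 a < k * (2 * rho0 a - c)).
  { replace (Derive u0 a * Derive u0 a) with (B * B * (k * c)).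
    - replace (k * (2 * rho0 a - c)) with ((1 + 2 * A) * (k * c)) by (unfold A; field; lra).
      apply Rmult_lt_compat_r; nra.
    - rewrite <- hwkc; unfold B; field; lra. }
  split.
  + assert (0 <= Derive u0 a * Derive u0 a) by nra. nra.
  + rewrite <- sqrt_Rsqr_abs; apply sqrt_lt_1_alt; unfold Rsqr; split; [nra|exact hq].
Qed.

Lemma trig_shift (w t : R) (n : nat) :
  0 < w ->
  cos (w * (t + 2 * INR n * PI / w)) = cos (w * t) /\
  sin (w * (t + 2 * INR n * PI / w)) = sin (w * t).
Proof.
intro hw.
replace (w * (t + 2 * INR n * PI / w)) with (w * t + 2 * INR n * PI) by (field; lra).
split; [apply cos_period|apply sin_period].
Qed.

Lemma period_beyond (w t tau : R) :
  0 < w -> exists n, tau < t + 2 * INR n * PI / w.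
Proof.
intro hw; pose proof PI_RGT_0 as hpi.
assert (hp : 0 < 2 * PI / w) by (apply Rdiv_lt_0_compat; lra).
destruct (Rle_lt_dec 0 (tau - t)) as [h|h].
- destruct (Rcomplements.nfloor_ex ((tau - t) / (2 * PI / w))) as [n hn].
  { apply Rmult_le_pos; [exact h|left; now apply Rinv_0_lt_compat]. }
  exists (S n); rewrite S_INR.
  assert (G : tau - t < (INR n + 1) * (2 * PI / w)).
  { apply (Rmult_lt_reg_r (/ (2 * PI / w))); [now apply Rinv_0_lt_compat|].
    rewrite Rmult_assoc, Rinv_r, Rmult_1_r by lra; apply hn. }
  replace (2 * (INR n + 1) * PI / w) with ((INR n + 1) * (2 * PI / w)) by (field; lra).
  lra.
- exists 0%nat; simpl; unfold Rdiv; lra.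
Qed.

(** Half a period reverses the sign, so one nonzero value yields both signs; whole periods push the
    two times beyond [tau]. *)
Lemma oscillation_both_signs (w A B tau : R) :
  0 < w -> A <> 0 \/ B <> 0 ->
  exists t1 t2, tau < t1 /\ tau < t2 /\
    A * cos (w * t1) + B * sin (w * t1) < 0 /\
    0 < A * cos (w * t2) + B * sin (w * t2).
Proof.
intros hw hAB.
assert (H : exists t, A * cos (w * t) + B * sin (w * t) <> 0).
{ destruct hAB as [h|h].
  - exists 0; rewrite Rmult_0_r, cos_0, sin_0; lra.
  - exists (PI / 2 / w); replace (w * (PI / 2 / w)) with (PI / 2) by (field; lra).
    rewrite cos_PI2, sin_PI2; lra. }
destruct H as [t ht].
assert (shift : forall s, exists s', tau < s' /\
  A * cos (w * s') + B * sin (w * s') = A * cos (w * s) + B * sin (w * s)).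
{ intro s; destruct (period_beyond w s tau hw) as [n hn].
  exists (s + 2 * INR n * PI / w); split; [exact hn|].
  now destruct (trig_shift w s n hw) as [-> ->]. }
destruct (shift t) as [s [hs Es]].
destruct (shift (t + PI / w)) as [s' [hs' Es']].
replace (w * (t + PI / w)) with (w * t + PI) in Es' by (field; lra).
rewrite neg_cos, neg_sin in Es'.
destruct (Rtotal_order (A * cos (w * t) + B * sin (w * t)) 0) as [h|[h|h]]; [|lra|].
- exists s, s'; repeat split; lra.
- exists s', s; repeat split; lra.
Qed.

(** G minus its mean takes both signs at arbitrarily late times, so rho crosses c; u_x = G_t / G is
    periodic and not identically zero, so it cannot tend to 0. *)
Lemma behaviour_along_characteristic (k c w : R) (rho0 u0 e : R -> R)
    (rho u E : R -> R -> R) :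
  flow_data k c w rho0 u0 e -> solution k c rho0 u0 p_infty rho u E ->
  forall a X, characteristic p_infty u a X ->
  rho0 a <> c \/ Derive u0 a <> 0 ->
  oscillates_around c (fun t => rho (X t) t) /\ ~ decays (fun t => dx u (X t) t).
Proof.
intros F S a X hX hne.
pose proof (fd_c _ _ _ _ _ _ F) as hc; pose proof (fd_w _ _ _ _ _ _ F) as hw.
pose proof (fd_rho0_pos _ _ _ _ _ _ F a) as hr.
pose proof (solution_along_characteristic _ _ _ _ _ _ _ _ _ _ F S a X hX) as H.
split.
- intro tau.
  destruct (oscillation_both_signs w (1 - rho0 a / c) (Derive u0 a / w) (Rmax 0 tau) hw)
    as [t1 [t2 [h1 [h2 [g1 g2]]]]].
  { destruct hne as [h|h]; [left|right].
    - intro G; apply h; apply (Rmult_eq_reg_r (/ c)); [|apply Rinv_neq_0_compat; lra].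
      rewrite Rinv_r by lra; unfold Rdiv in G; lra.
    - intro G; apply h; apply (Rmult_eq_reg_r (/ w)); [|apply Rinv_neq_0_compat; lra].
      rewrite Rmult_0_l; exact G. }
  pose proof (Rmax_l 0 tau); pose proof (Rmax_r 0 tau).
  (* The order is reversed: a larger Jacobian means a smaller density. *)
  exists t2, t1; split; [lra|]; split; [lra|].
  destruct (H t1 ltac:(lra) I) as [_ [j1 ->]].
  destruct (H t2 ltac:(lra) I) as [_ [j2 ->]].
  assert (hrc : rho0 a / c * c = rho0 a) by (field; lra).
  split.
  + apply (Rmult_lt_reg_r (jac c w rho0 u0 a t2)); [easy|].
    replace (rho0 a / jac c w rho0 u0 a t2 * jac c w rho0 u0 a t2) with (rho0 a) by (field; lra).
    rewrite <- hrc at 1; rewrite Rmult_comm; apply Rmult_lt_compat_l; [exact hc|].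
    rewrite jac_amplitude by exact hc; lra.
  + apply (Rmult_lt_reg_r (jac c w rho0 u0 a t1)); [easy|].
    replace (rho0 a / jac c w rho0 u0 a t1 * jac c w rho0 u0 a t1) with (rho0 a) by (field; lra).
    rewrite <- hrc at 1; rewrite (Rmult_comm (rho0 a / c)); apply Rmult_lt_compat_l; [exact hc|].
    rewrite jac_amplitude by exact hc; lra.
- intro D.
  (* A quarter period sees the coefficient rho0 - c of G_t, and time 0 sees u0'. *)
  assert (Z : exists t, 0 <= t /\ dosc c w (rho0 a - c) (Derive u0 a) t <> 0).
  { destruct hne as [h|h].
    - exists (PI / 2 / w); split.
      + pose proof PI_RGT_0; apply Rmult_le_pos; [lra|left; now apply Rinv_0_lt_compat].
      + unfold dosc; replace (w * (PI / 2 / w)) with (PI / 2) by (field; lra).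
        rewrite cos_PI2, sin_PI2, Rmult_0_r, Rmult_1_r, Rplus_0_r; unfold Rdiv.
        repeat apply Rmult_integral_contrapositive_currified; try lra.
        apply Rinv_neq_0_compat; lra.
    - exists 0; split; [lra|]; now rewrite dosc_0. }
  destruct Z as [t [ht hz]].
  set (v := dosc c w (rho0 a - c) (Derive u0 a) t / jac c w rho0 u0 a t).
  assert (hv : 0 < Rabs v).
  { apply Rabs_pos_lt; unfold v, Rdiv; apply Rmult_integral_contrapositive_currified;
      [exact hz|]; apply Rinv_neq_0_compat; destruct (H t ht I) as [_ [hJ _]]; lra. }
  apply is_lim_spec in D; destruct (D (mkposreal _ hv)) as [M HM]; simpl in HM.
  destruct (period_beyond w t (Rmax 0 M) hw) as [n hn].
  pose proof (Rmax_l 0 M); pose proof (Rmax_r 0 M).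
  specialize (HM (t + 2 * INR n * PI / w) ltac:(lra)).
  assert (hpos : 0 < t + 2 * INR n * PI / w) by lra.
  rewrite (solution_gradient _ _ _ _ _ _ _ _ _ _ F S a X hX _ hpos I), Rminus_0_r in HM.
  unfold v, jac, dosc, osc in HM.
  destruct (trig_shift w t n hw) as [E1 E2]; rewrite E1, E2 in HM; lra.
Qed.

Lemma lim_infty_far (f : R -> R) (l eps : R) :
  (forall x, x = m_infty \/ x = p_infty -> is_lim f x l) -> 0 < eps ->
  exists N, 0 < N /\ forall a, N < Rabs a -> Rabs (f a - l) < eps.
Proof.
intros H he.
pose proof (H m_infty (or_introl eq_refl)) as h1; apply is_lim_spec in h1.
pose proof (H p_infty (or_intror eq_refl)) as h2; apply is_lim_spec in h2.
destruct (h1 (mkposreal eps he)) as [M1 H1]; destruct (h2 (mkposreal eps he)) as [M2 H2].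
simpl in H1, H2.
exists (Rmax 1 (Rmax (- M1) M2)).
pose proof (Rmax_l 1 (Rmax (- M1) M2)); pose proof (Rmax_r 1 (Rmax (- M1) M2)).
pose proof (Rmax_l (- M1) M2); pose proof (Rmax_r (- M1) M2).
split; [lra|]; intros a ha.
revert ha; unfold Rabs at 1; destruct Rcase_abs; intro ha; [apply H1|apply H2]; lra.
Qed.

(** Beyond [N] both coefficients of G are below 1/4 in absolute value, so G > 1 - 2/4 - 1/4 - which
    is positive - at every time. Questions about all labels thus reduce to a compact interval. *)
Lemma jac_far_pos (k c w : R) (rho0 u0 e : R -> R) :
  flow_data k c w rho0 u0 e ->
  exists N, 0 < N /\ forall a t, N < Rabs a -> 0 < jac c w rho0 u0 a t.
Proof.
intro F.
pose proof (fd_c _ _ _ _ _ _ F) as hc; pose proof (fd_w _ _ _ _ _ _ F) as hw.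
destruct (lim_infty_far rho0 c (c / 4) (fd_rho0_lim _ _ _ _ _ _ F)) as [N1 [hN1 H1]]; [lra|].
destruct (lim_infty_far (Derive u0) 0 (w / 4) (fd_du0_lim _ _ _ _ _ _ F)) as [N2 [hN2 H2]]; [lra|].
pose proof (Rmax_l N1 N2); pose proof (Rmax_r N1 N2).
exists (Rmax N1 N2); split; [lra|]; intros a t ha.
specialize (H1 a ltac:(lra)); specialize (H2 a ltac:(lra)).
rewrite Rminus_0_r in H2.
assert (G1 : Rabs ((rho0 a - c) / c) < / 4).
{ unfold Rdiv; rewrite Rabs_mult, (Rabs_pos_eq (/ c)) by (left; now apply Rinv_0_lt_compat).
  apply (Rmult_lt_reg_r c); [exact hc|]; rewrite Rmult_assoc, Rinv_l by lra; lra. }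
assert (G2 : Rabs (Derive u0 a / w) < / 4).
{ unfold Rdiv; rewrite Rabs_mult, (Rabs_pos_eq (/ w)) by (left; now apply Rinv_0_lt_compat).
  apply (Rmult_lt_reg_r w); [exact hw|]; rewrite Rmult_assoc, Rinv_l by lra; lra. }
apply Rabs_def2 in G1; apply Rabs_def2 in G2.
unfold jac, osc.
pose proof (COS_bound (w * t)); pose proof (SIN_bound (w * t)).
assert (- (1 / 2) <= (rho0 a - c) / c * (1 - cos (w * t))) by nra.
assert (- (1 / 4) <= Derive u0 a / w * sin (w * t)) by nra.
lra.
Qed.

Lemma jac_continuity_2d (k c w : R) (rho0 u0 e : R -> R) (a t : R) :
  flow_data k c w rho0 u0 e -> continuity_2d_pt (jac c w rho0 u0) a t.
Proof.
intro F; apply (continuity_2d_pt_plus (fun _ _ => 1)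
  (fun a t => osc c w (rho0 a - c) (Derive u0 a) t)); [apply continuity_2d_pt_const|].
apply (osc_continuity_2d c w (fun a => rho0 a - c) (Derive u0)); [|apply F].
apply (continuous_minus rho0 (fun _ => c)); [apply F|apply continuous_const].
Qed.

(** On [-N, N] the Jacobian at time t has a positive minimum, and uniform continuity keeps its
    variation below that minimum for nearby times; larger labels are covered by [jac_far_pos]. *)
Lemma jac_pos_persists (k c w : R) (rho0 u0 e : R -> R) (t : R) :
  flow_data k c w rho0 u0 e -> (forall a, 0 < jac c w rho0 u0 a t) ->
  exists d, 0 < d /\ forall s, Rabs (s - t) < d -> forall a, 0 < jac c w rho0 u0 a s.
Proof.
intros F H.
destruct (jac_far_pos k c w rho0 u0 e F) as [N [hN HN]].
destruct (continuity_ab_min (fun a => jac c w rho0 u0 a t) (- N) N ltac:(lra))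
  as [a0 [Ha0 _]].
{ intros a _; apply eps_continuity_pt; intros eps he.
  destruct (jac_continuity_2d k c w rho0 u0 e a t F (mkposreal eps he)) as [d Hd].
  exists d; split; [apply cond_pos|]; intros y hy; apply Hd; [exact hy|].
  rewrite Rminus_diag, Rabs_R0; apply cond_pos. }
destruct (uniform_continuity_2d (jac c w rho0 u0) (- N) N (t - 1) (t + 1)) with
  (eps := mkposreal _ (H a0)) as [d Hd].
{ intros; now apply (jac_continuity_2d k c w rho0 u0 e). }
simpl in Hd.
exists (Rmin 1 d); split; [apply Rmin_glb_lt; [lra|apply cond_pos]|].
intros s hs a; pose proof (Rmin_l 1 d); pose proof (Rmin_r 1 d).
destruct (Rle_lt_dec (Rabs a) N) as [ha|ha]; [|now apply HN].
apply Rabs_le_between in ha.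
specialize (Ha0 a ha).
specialize (Hd a t a s ha ltac:(lra) ha).
rewrite Rminus_diag, Rabs_R0 in Hd.
assert (hs' : t - 1 <= s <= t + 1).
{ assert (G : Rabs (s - t) < 1) by lra; apply Rabs_def2 in G; lra. }
specialize (Hd hs' (cond_pos d) ltac:(lra)).
apply Rabs_def2 in Hd; lra.
Qed.

(** [Tb] is the supremum of the times up to which G is positive for all labels. Were G positive for
    all labels at [Tb] too, [jac_pos_persists] would carry positivity past the supremum. *)
Lemma critical_time (k c w : R) (rho0 u0 e : R -> R) :
  flow_data k c w rho0 u0 e -> ~ subcritical k c rho0 u0 ->
  exists Tb, 0 < Tb /\
    (forall a t, 0 <= t < Tb -> 0 < jac c w rho0 u0 a t) /\
    exists a, jac c w rho0 u0 a Tb <= 0.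
Proof.
intros F hns.
assert (Hbad : exists t0, 0 <= t0 /\ exists a, jac c w rho0 u0 a t0 <= 0).
{ apply NNPP; intro N; apply hns, (jac_pos_subcritical _ _ _ _ _ _ F).
  intros a t ht; apply Rnot_le_lt; intro hle; apply N; eauto. }
destruct Hbad as [t0 [ht0 [a0 ha0]]].
set (B := fun s => 0 <= s /\ forall t, 0 <= t <= s -> forall a, 0 < jac c w rho0 u0 a t).
assert (J0 : forall a, 0 < jac c w rho0 u0 a 0).
{ intro a; unfold jac; rewrite osc_0; lra. }
assert (B0 : B 0).
{ split; [lra|]; intros t ht a; replace t with 0 by lra; apply J0. }
destruct (completeness B) as [Tb [ub lub]].
{ exists t0; intros s [hs1 hs2]; apply Rnot_lt_le; intro h.
  specialize (hs2 t0 ltac:(lra) a0); lra. }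
{ now exists 0. }
assert (below : forall t, 0 <= t < Tb -> forall a, 0 < jac c w rho0 u0 a t).
{ intros t ht a; apply NNPP; intro N.
  enough (Tb <= t) by lra.
  apply lub; intros s [hs1 hs2]; apply Rnot_lt_le; intro h; apply N, hs2; lra. }
assert (Tb0 : 0 <= Tb) by now apply ub.
assert (notall : ~ forall a, 0 < jac c w rho0 u0 a Tb).
{ intro all; destruct (jac_pos_persists _ _ _ _ _ _ Tb F all) as [d [hd Hd]].
  enough (Tb + d / 2 <= Tb) by lra.
  apply ub; split; [lra|]; intros t ht a.
  destruct (Rlt_dec t Tb); [apply below; lra|].
  apply Hd, Rabs_def1; lra. }
exists Tb; split; [|split].
- destruct Tb0 as [|<-]; [easy|]; contradiction.
- intros a t ht; now apply below.
- apply not_all_ex_not in notall; destruct notall as [a ha].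
  exists a; now apply Rnot_lt_le.
Qed.

(** Before [Tb] the Jacobian at [a] is positive, and by continuity it becomes arbitrarily small,
    which makes rho0 / G unbounded. As u_x is the logarithmic derivative of G, a bound on it would
    keep G above a positive exponential. *)
Lemma breakdown (k c w : R) (rho0 u0 e : R -> R) (Tb a : R) (rho u E : R -> R -> R) :
  flow_data k c w rho0 u0 e -> 0 < Tb -> jac c w rho0 u0 a Tb <= 0 ->
  solution k c rho0 u0 Tb rho u E ->
  forall X, characteristic Tb u a X ->
    unbounded_before Tb (fun t => rho (X t) t) /\
    unbounded_before Tb (fun t => dx u (X t) t).
Proof.
intros F hTb hj S X hX.
assert (hw : w <> 0) by (pose proof (fd_w _ _ _ _ _ _ F); lra).
pose proof (fd_rho0_pos _ _ _ _ _ _ F a) as hr.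
pose proof (solution_along_characteristic _ _ _ _ _ _ _ _ _ _ F S a X hX) as H.
assert (cJ : forall t, continuity_pt (fun s => jac c w rho0 u0 a s) t).
{ intro t; eapply is_derive_continuity_pt; now apply jac_derive_time. }
split; intro M.
- assert (hM : 0 < Rabs M + 1) by (pose proof (Rabs_pos M); lra).
  assert (he : 0 < rho0 a / (Rabs M + 1)) by now apply Rdiv_lt_0_compat.
  destruct (continuity_pt_eps _ _ (cJ Tb) _ he) as [d [hd Hd]].
  set (t := Rmax 0 (Tb - d / 2)).
  assert (h1 : 0 <= t) by apply Rmax_l.
  assert (h2 : Tb - d / 2 <= t) by apply Rmax_r.
  assert (h3 : t < Tb) by (apply Rmax_lub_lt; lra).
  exists t; split; [lra|].
  destruct (H t h1 h3) as [_ [hJ ->]].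
  assert (hlt : jac c w rho0 u0 a t < rho0 a / (Rabs M + 1)).
  { specialize (Hd t ltac:(apply Rabs_def1; lra)); apply Rabs_def2 in Hd; lra. }
  apply Rlt_le_trans with (2 := Rle_abs _).
  apply Rle_lt_trans with (1 := Rle_abs M).
  apply Rlt_trans with (Rabs M + 1); [lra|].
  apply (Rmult_lt_reg_r (jac c w rho0 u0 a t)); [easy|].
  replace (rho0 a / jac c w rho0 u0 a t * jac c w rho0 u0 a t) with (rho0 a) by (field; lra).
  replace (rho0 a) with ((Rabs M + 1) * (rho0 a / (Rabs M + 1))) by (field; lra).
  now apply Rmult_lt_compat_l.
(* A bound [M] on u_x means |G_t| <= M |G|, and Gronwall from G = 1 at time 0 gives G >= exp(-M Tb)
   > 0 at [Tb]. *)
- apply NNPP; intro N.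
  assert (hb : forall t, 0 < t < Tb -> Rabs (dosc c w (rho0 a - c) (Derive u0 a) t) <=
    M * Rabs (jac c w rho0 u0 a t)).
  { intros t ht; destruct (H t ltac:(lra) (proj2 ht)) as [_ [hJ _]].
    assert (hu : Rabs (dx u (X t) t) <= M).
    { apply Rnot_lt_le; intro h; apply N; exists t; split; [lra|exact h]. }
    rewrite (solution_gradient _ _ _ _ _ _ _ _ _ _ F S a X hX t (proj1 ht) (proj2 ht)) in hu.
    replace (dosc c w (rho0 a - c) (Derive u0 a) t) with
      (dosc c w (rho0 a - c) (Derive u0 a) t / jac c w rho0 u0 a t * jac c w rho0 u0 a t)
      by (field; lra).
    rewrite Rabs_mult; apply Rmult_le_compat_r; [apply Rabs_pos|exact hu]. }
  pose proof (gronwall_pos (fun s => jac c w rho0 u0 a s) _ M Tb ltac:(lra)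
    (fun s _ => cJ s) (fun s _ => jac_derive_time c w rho0 u0 a s hw) hb) as G.
  cbv beta in G; unfold jac at 1 2 in G; rewrite osc_0, Rplus_0_r, Rmult_1_l in G.
  specialize (G Rlt_0_1); pose proof (exp_pos (- M * Tb)); lra.
Qed.

(** * Construction of the solution *)

(** The inverse of the flow in the label, obtained by choice: [flow_label] gives surjectivity, and
    [label_flow] uniqueness once the Jacobian is positive. *)
Definition label (c w : R) (e u0 : R -> R) (x t : R) : R :=
  epsilon (inhabits 0) (fun a => flow c w e u0 a t = x).

Definition jac_pos_on (c w : R) (rho0 u0 : R -> R) (T : Rbar) : Prop :=
  forall a t, 0 <= t -> Rbar_lt t T -> 0 < jac c w rho0 u0 a t.

(** The flow is a plus a term vanishing at both infinities, hence onto by the intermediate value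
    theorem. Being valid for every real [t], the identity holds on the full neighbourhoods asked for
    by [implicit_derive]. *)
Lemma flow_label (k c w : R) (rho0 u0 e : R -> R) (x t : R) :
  flow_data k c w rho0 u0 e -> flow c w e u0 (label c w e u0 x t) t = x.
Proof.
intro F; apply (epsilon_spec (inhabits 0) (fun a => flow c w e u0 a t = x)).
assert (L : forall y, y = m_infty \/ y = p_infty ->
  is_lim (fun a => flow c w e u0 a t) y y).
{ intros y hy; apply (is_lim_shift_infty (fun a => osc c w (e a) (u0 a) t) y 0 hy).
  apply osc_lim_0; now apply F. }
destruct (IVT_Rbar_incr (fun a => flow c w e u0 a t) m_infty p_infty m_infty p_infty x)
  as [a [_ [_ Ha]]]; auto; try easy.
- intros a _ _; eapply is_derive_continuity_pt, flow_derive_label, F.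
- now exists a.
Qed.

Lemma flow_increasing (k c w : R) (rho0 u0 e : R -> R) (T : Rbar) (a b t : R) :
  flow_data k c w rho0 u0 e -> jac_pos_on c w rho0 u0 T ->
  0 <= t -> Rbar_lt t T -> a < b -> flow c w e u0 a t < flow c w e u0 b t.
Proof.
intros F hJ ht hT hab.
destruct (derive_mean_value (fun a => flow c w e u0 a t) (fun a => jac c w rho0 u0 a t) a b)
  as [z [_ E]].
- intros z _; now apply (flow_derive_label k).
- specialize (hJ z t ht hT); nra.
Qed.

Lemma flow_lt_inv (k c w : R) (rho0 u0 e : R -> R) (T : Rbar) (a b t : R) :
  flow_data k c w rho0 u0 e -> jac_pos_on c w rho0 u0 T ->
  0 <= t -> Rbar_lt t T -> flow c w e u0 a t < flow c w e u0 b t -> a < b.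
Proof.
intros F hJ ht hT h; destruct (Rtotal_order a b) as [|[->|g]]; [easy|lra|].
pose proof (flow_increasing k c w rho0 u0 e T b a t F hJ ht hT g); lra.
Qed.

Lemma label_flow (k c w : R) (rho0 u0 e : R -> R) (T : Rbar) (a t : R) :
  flow_data k c w rho0 u0 e -> jac_pos_on c w rho0 u0 T ->
  0 <= t -> Rbar_lt t T -> label c w e u0 (flow c w e u0 a t) t = a.
Proof.
intros F hJ ht hT.
pose proof (flow_label k c w rho0 u0 e (flow c w e u0 a t) t F) as E.
destruct (Rtotal_order (label c w e u0 (flow c w e u0 a t) t) a) as [h|[h|h]]; [|easy|];
  apply (flow_increasing k c w rho0 u0 e T _ _ t F hJ ht hT) in h; lra.
Qed.

(** Monotonicity traps the label: for (y, s) near (x, t), y stays strictly between the positions at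
    time s of the characteristics issued from a - eps and a + eps. *)
Lemma label_C0 (k c w : R) (rho0 u0 e : R -> R) (T : Rbar) :
  flow_data k c w rho0 u0 e -> jac_pos_on c w rho0 u0 T ->
  C0_strip T (label c w e u0).
Proof.
intros F hJ; apply eps_C0_strip; intros x t ht hT eps he.
assert (hw : w <> 0) by (pose proof (fd_w _ _ _ _ _ _ F); lra).
set (a := label c w e u0 x t).
assert (Ea : flow c w e u0 a t = x) by now apply (flow_label k c w rho0).
pose proof (flow_increasing k c w rho0 u0 e T (a - eps) a t F hJ ht hT ltac:(lra)) as h1.
pose proof (flow_increasing k c w rho0 u0 e T a (a + eps) t F hJ ht hT ltac:(lra)) as h2.
rewrite Ea in h1, h2.
(* Half of the smaller margin at time t: one half pays for moving x to y, the other for the motion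
   of the two characteristics. *)
set (eta := Rmin (x - flow c w e u0 (a - eps) t) (flow c w e u0 (a + eps) t - x) / 2).
assert (g1 : 2 * eta <= x - flow c w e u0 (a - eps) t).
{ replace (2 * eta) with (Rmin (x - flow c w e u0 (a - eps) t) (flow c w e u0 (a + eps) t - x))
    by (unfold eta; field); apply Rmin_l. }
assert (g2 : 2 * eta <= flow c w e u0 (a + eps) t - x).
{ replace (2 * eta) with (Rmin (x - flow c w e u0 (a - eps) t) (flow c w e u0 (a + eps) t - x))
    by (unfold eta; field); apply Rmin_r. }
assert (heta : 0 < eta).
{ unfold eta; assert (0 < Rmin (x - flow c w e u0 (a - eps) t) (flow c w e u0 (a + eps) t - x))
    by (apply Rmin_glb_lt; lra); lra. }
assert (ct : forall b, continuity_pt (fun s => flow c w e u0 b s) t).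
{ intro b; eapply is_derive_continuity_pt; now apply flow_derive_time. }
destruct (continuity_pt_eps _ _ (ct (a - eps)) eta heta) as [d1 [hd1 H1]].
destruct (continuity_pt_eps _ _ (ct (a + eps)) eta heta) as [d2 [hd2 H2]].
exists (Rmin eta (Rmin d1 d2)); split; [repeat apply Rmin_glb_lt; assumption|].
intros y s hy hs hs0 hsT.
pose proof (Rmin_l eta (Rmin d1 d2)); pose proof (Rmin_r eta (Rmin d1 d2)).
pose proof (Rmin_l d1 d2); pose proof (Rmin_r d1 d2).
specialize (H1 s ltac:(lra)); specialize (H2 s ltac:(lra)).
assert (hy' : Rabs (y - x) < eta) by lra.
apply Rabs_def2 in H1; apply Rabs_def2 in H2; apply Rabs_def2 in hy'.
pose proof (flow_label k c w rho0 u0 e y s F) as Ey.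
apply Rabs_def1.
- enough (label c w e u0 y s < a + eps) by lra.
  apply (flow_lt_inv k c w rho0 u0 e T _ _ s F hJ hs0 hsT); rewrite Ey; lra.
- enough (a - eps < label c w e u0 y s) by lra.
  apply (flow_lt_inv k c w rho0 u0 e T _ _ s F hJ hs0 hsT); rewrite Ey; lra.
Qed.

Lemma label_lim (k c w : R) (rho0 u0 e : R -> R) (T : Rbar) (t : R) (x : Rbar) :
  flow_data k c w rho0 u0 e -> jac_pos_on c w rho0 u0 T ->
  0 <= t -> Rbar_lt t T -> x = m_infty \/ x = p_infty ->
  is_lim (fun y => label c w e u0 y t) x x.
Proof.
intros F hJ ht hT [-> | ->]; apply is_lim_spec; intro M;
  exists (flow c w e u0 M t); intros y hy;
  apply (flow_lt_inv k c w rho0 u0 e T _ _ t F hJ ht hT);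
  now rewrite (flow_label k c w rho0).
Qed.

Lemma C0_strip_point (T : Rbar) (f : R -> R -> R) (x t : R) :
  C0_strip T f -> 0 <= t -> Rbar_lt t T -> continuity_pt (fun y => f y t) x.
Proof.
intros H ht hT; apply eps_continuity_pt; intros eps he.
destruct (C0_strip_eps T f H x t ht hT eps he) as [d [hd Hd]].
exists d; split; [exact hd|]; intros y hy; apply Hd; try easy.
now rewrite Rminus_diag, Rabs_R0.
Qed.

Lemma C0_strip_time (T : Rbar) (f : R -> R -> R) (x t : R) :
  C0_strip T f -> 0 < t -> Rbar_lt t T -> continuity_pt (fun s => f x s) t.
Proof.
intros H ht hT; apply eps_continuity_pt; intros eps he.
destruct (C0_strip_eps T f H x t ltac:(lra) hT eps he) as [d [hd Hd]].
destruct (Rbar_lt_near T t hT) as [d' [hd' HT]].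
exists (Rmin t (Rmin d d')); split; [repeat apply Rmin_glb_lt; assumption|].
pose proof (Rmin_l t (Rmin d d')); pose proof (Rmin_r t (Rmin d d')).
pose proof (Rmin_l d d'); pose proof (Rmin_r d d').
intros s hs; apply Hd; [now rewrite Rminus_diag, Rabs_R0|lra| |apply HT; lra].
assert (G : Rabs (s - t) < t) by lra; apply Rabs_def2 in G; lra.
Qed.

Lemma label_dx (k c w : R) (rho0 u0 e : R -> R) (T : Rbar) (x t : R) :
  flow_data k c w rho0 u0 e -> jac_pos_on c w rho0 u0 T ->
  0 <= t -> Rbar_lt t T ->
  is_derive (fun y => label c w e u0 y t) x (/ jac c w rho0 u0 (label c w e u0 x t) t).
Proof.
intros F hJ ht hT; eapply is_derive_eq.
(* Here the parameter of [implicit_derive] is the position, with t frozen: the flow is constant in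
   it, and the right-hand side is the identity. *)
- apply (implicit_derive (fun a _ => flow c w e u0 a t) (fun a _ => jac c w rho0 u0 a t)
    (fun y => label c w e u0 y t) (fun y => y) x 1 0 1).
  + exists (mkposreal 1 Rlt_0_1); intros; now apply (flow_derive_label k).
  + intro eps; destruct (jac_continuity_2d k c w rho0 u0 e
      (label c w e u0 x t) t F eps) as [d Hd].
    exists d; intros y s hy _; apply Hd; [exact hy|].
    rewrite Rminus_diag, Rabs_R0; apply cond_pos.
  + now apply hJ.
  + apply (is_derive_const (V := R_NormedModule)).
  + exact (is_derive_id (K := R_AbsRing) x).
  + apply (C0_strip_point T (label c w e u0)); [|easy|easy].
    now apply (label_C0 k c w rho0).
  + lra.
  + intros; now apply (flow_label k c w rho0).
- ring.
Qed.

Lemma label_dt (k c w : R) (rho0 u0 e : R -> R) (T : Rbar) (x t : R) :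
  flow_data k c w rho0 u0 e -> jac_pos_on c w rho0 u0 T ->
  0 < t -> Rbar_lt t T ->
  is_derive (fun s => label c w e u0 x s) t
    (- (dosc c w (e (label c w e u0 x t)) (u0 (label c w e u0 x t)) t /
        jac c w rho0 u0 (label c w e u0 x t) t)).
Proof.
intros F hJ ht hT.
assert (hw : w <> 0) by (pose proof (fd_w _ _ _ _ _ _ F); lra).
eapply is_derive_eq.
- apply (implicit_derive (flow c w e u0) (jac c w rho0 u0)
    (fun s => label c w e u0 x s) (fun _ => x) t 0
    (dosc c w (e (label c w e u0 x t)) (u0 (label c w e u0 x t)) t) 1).
  + exists (mkposreal 1 Rlt_0_1); intros; now apply (flow_derive_label k).
  + now apply (jac_continuity_2d k c w rho0 u0 e).
  + apply hJ; [lra|easy].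
  + now apply flow_derive_time.
  + apply (is_derive_const (V := R_NormedModule)).
  + apply (C0_strip_time T (label c w e u0)); [|easy|easy].
    now apply (label_C0 k c w rho0).
  + lra.
  + intros; now apply (flow_label k c w rho0).
- unfold Rdiv; ring.
Qed.

(* [f], given in Lagrangian coordinates with partial derivatives [fa], [ft], is
   of class C^1 in Eulerian coordinates. *)
Lemma eulerian_C1 (k c w : R) (rho0 u0 e : R -> R) (T : Rbar) (f fa ft : R -> R -> R) :
  flow_data k c w rho0 u0 e -> jac_pos_on c w rho0 u0 T ->
  (forall a t, 0 <= t -> Rbar_lt t T -> is_derive (fun b => f b t) a (fa a t)) ->
  (forall a t, 0 <= t -> Rbar_lt t T -> is_derive (fun s => f a s) t (ft a t)) ->
  (forall a t, 0 <= t -> Rbar_lt t T -> continuity_2d_pt fa a t) ->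
  let A := label c w e u0 in
  (forall x t, 0 <= t -> Rbar_lt t T ->
     is_derive (fun y => f (A y t) t) x (fa (A x t) t / jac c w rho0 u0 (A x t) t)) /\
  (forall x t, 0 < t -> Rbar_lt t T ->
     is_derive (fun s => f (A x s) s) t
       (ft (A x t) t - fa (A x t) t * dosc c w (e (A x t)) (u0 (A x t)) t /
          jac c w rho0 u0 (A x t) t)).
Proof.
intros F hJ ha ht hc A; split.
- intros x t h0 hT; eapply is_derive_eq.
  + apply (is_derive_comp (fun b => f b t) (fun y => A y t)).
    * now apply ha.
    * now apply (label_dx k c w rho0 u0 e T).
  + unfold scal; simpl; unfold mult; simpl; unfold A, Rdiv; ring.
- intros x t h0 hT; eapply is_derive_eq.
  + apply (chain_rule_2d f fa (fun s => A x s)).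
    * destruct (Rbar_lt_near T t hT) as [d [hd Hd]].
      assert (hm : 0 < Rmin d t) by now apply Rmin_glb_lt.
      exists (mkposreal _ hm); simpl; intros b s _ hs.
      pose proof (Rmin_l d t); pose proof (Rmin_r d t).
      apply ha; [|apply Hd; lra].
      assert (G : Rabs (s - t) < t) by lra; apply Rabs_def2 in G; lra.
    * apply hc; [lra|easy].
    * apply ht; [lra|easy].
    * now apply (label_dt k c w rho0 u0 e T).
  + unfold A, Rdiv; ring.
Qed.

Lemma eulerian_C0 (k c w : R) (rho0 u0 e : R -> R) (T : Rbar) (f : R -> R -> R) :
  flow_data k c w rho0 u0 e -> jac_pos_on c w rho0 u0 T ->
  (forall a t, 0 <= t -> Rbar_lt t T -> continuity_2d_pt f a t) ->
  C0_strip T (fun x t => f (label c w e u0 x t) t).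
Proof.
intros F hJ hc; apply eps_C0_strip; intros x t ht hT eps he.
destruct (hc (label c w e u0 x t) t ht hT (mkposreal eps he)) as [d Hd]; simpl in Hd.
destruct (C0_strip_eps T _ (label_C0 k c w rho0 u0 e T F hJ) x t ht hT d (cond_pos d))
  as [d' [hd' Hd']].
exists (Rmin d d'); split; [apply Rmin_glb_lt; [apply cond_pos|exact hd']|].
pose proof (Rmin_l d d'); pose proof (Rmin_r d d').
intros y s hy hs h0 hT'; apply Hd; [apply Hd'; try easy; lra|lra].
Qed.

Lemma eulerian_lim (k c w : R) (rho0 u0 e : R -> R) (T : Rbar) (f : R -> R) (t l : R) (x : Rbar) :
  flow_data k c w rho0 u0 e -> jac_pos_on c w rho0 u0 T ->
  0 <= t -> Rbar_lt t T -> x = m_infty \/ x = p_infty ->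
  is_lim f x l -> is_lim (fun y => f (label c w e u0 y t)) x l.
Proof.
intros F hJ ht hT hx hf.
apply (is_lim_comp f (fun y => label c w e u0 y t) x l x hf).
- now apply (label_lim k c w rho0 u0 e T).
- destruct hx as [-> | ->]; exists 0; intros; discriminate.
Qed.

Lemma jac_lim (k c w : R) (rho0 u0 e : R -> R) (t : R) (x : Rbar) :
  flow_data k c w rho0 u0 e -> x = m_infty \/ x = p_infty ->
  is_lim (fun a => jac c w rho0 u0 a t) x 1.
Proof.
intros F hx.
replace (Finite 1) with (Finite (1 + 0)) by (f_equal; ring).
apply (is_lim_plus' (fun _ => 1)); [apply is_lim_const|].
apply (osc_lim_0 c w t (fun a => rho0 a - c)); [|now apply F].
replace (Finite 0) with (Finite (c - c)) by (f_equal; ring).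
apply is_lim_minus'; [now apply F|apply is_lim_const].
Qed.

Lemma dosc_jac_continuity_2d (k c w : R) (rho0 u0 e : R -> R) (a t : R) :
  flow_data k c w rho0 u0 e ->
  continuity_2d_pt (fun a t => dosc c w (rho0 a - c) (Derive u0 a) t) a t.
Proof.
intro F; apply (dosc_continuity_2d c w (fun a => rho0 a - c) (Derive u0)); [|apply F].
apply (continuous_minus rho0 (fun _ => c)); [apply F|apply continuous_const].
Qed.

Lemma is_derive_continuous (f : R -> R) (x l : R) : is_derive f x l -> continuous f x.
Proof. intro h; apply (ex_derive_continuous f); now exists l. Qed.

Lemma flow_characteristic (k c w : R) (rho0 u0 e : R -> R) (T : Rbar) (a : R) :
  flow_data k c w rho0 u0 e -> jac_pos_on c w rho0 u0 T ->
  characteristic T (fun x t => dosc c w (e (label c w e u0 x t)) (u0 (label c w e u0 x t)) t)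
    a (fun t => flow c w e u0 a t).
Proof.
intros F hJ.
assert (hw : w <> 0) by (pose proof (fd_w _ _ _ _ _ _ F); lra).
split; [apply flow_0|split].
- apply continuous_on_forall; intros t _.
  eapply is_derive_continuous; now apply flow_derive_time.
- intros t ht hT; rewrite (label_flow k c w rho0 u0 e T) by (try easy; lra).
  now apply flow_derive_time.
Qed.

Lemma is_RInt_gen_primitive (f g : R -> R) (Fa Fb : (R -> Prop) -> Prop)
    (FFa : Filter Fa) (FFb : Filter Fb) (la lb : R) :
  (forall x, is_derive f x (g x)) -> (forall x, continuous g x) ->
  filterlim f Fa (locally la) -> filterlim f Fb (locally lb) ->
  is_RInt_gen g Fa Fb (lb - la).
Proof.
intros hd hg ha hb.
assert (E : forall x, Derive f x = g x) by (intro; now apply is_derive_unique).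
apply (is_RInt_gen_ext (Derive f)).
- apply filter_forall; intros; apply E.
- apply is_RInt_gen_Derive; try assumption; apply filter_forall; intros p x _.
  + now exists (g x).
  + apply (continuous_ext g); [intro; now rewrite E|apply hg].
Qed.

(** Every field is a Lagrangian oscillator read at the label; a spatial derivative is then a label
    derivative divided by the Jacobian. *)
Lemma eulerian_solution (k c w : R) (rho0 u0 e : R -> R) (T : Rbar) :
  flow_data k c w rho0 u0 e -> jac_pos_on c w rho0 u0 T ->
  exists rho u E, solution k c rho0 u0 T rho u E.
Proof.
intros F hJ.
set (A := label c w e u0).
pose proof (fd_k _ _ _ _ _ _ F) as hk; pose proof (fd_c _ _ _ _ _ _ F) as hc.
pose proof (fd_w _ _ _ _ _ _ F) as hw; pose proof (fd_wkc _ _ _ _ _ _ F) as hwkc.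
assert (hw0 : w <> 0) by lra.
assert (ce : forall a, continuous e a).
{ intro a; eapply is_derive_continuous; apply F. }
assert (cu0 : forall a, continuous u0 a).
{ intro a; eapply is_derive_continuous; apply F. }
set (rho := fun x t => rho0 (A x t) / jac c w rho0 u0 (A x t) t).
set (u := fun x t => dosc c w (e (A x t)) (u0 (A x t)) t).
(* The momentum equation dictates this choice, k E being the acceleration. Poisson's equation
   follows because the label derivative of [ddosc] is k (rho0 - c J), and dividing by k J gives rho0
   / J - c. *)
set (E := fun x t => ddosc c w (e (A x t)) (u0 (A x t)) t * / k).
assert (crho : C0_strip T rho).
{ apply (eulerian_C0 k c w rho0 u0 e T (fun a t => rho0 a / jac c w rho0 u0 a t) F hJ).
  intros a t ht hT; apply (continuity_2d_pt_mult (fun a _ => rho0 a)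
    (fun a t => / jac c w rho0 u0 a t)).
  - apply continuity_2d_pt_filterlim.
    apply (continuous_comp (fst : R * R -> R) rho0); [apply continuous_fst|apply F].
  - apply continuity_2d_pt_inv; [now apply (jac_continuity_2d k c w rho0 u0 e)|].
    specialize (hJ a t ht hT); lra. }
destruct (eulerian_C1 k c w rho0 u0 e T (fun a t => dosc c w (e a) (u0 a) t)
  (fun a t => dosc c w (rho0 a - c) (Derive u0 a) t)
  (fun a t => ddosc c w (e a) (u0 a) t) F hJ) as [ux ut].
{ intros; apply dosc_derive_coeff; apply F. }
{ intros; apply dosc_derive. }
{ intros; now apply (dosc_jac_continuity_2d k c w rho0 u0 e). }
fold A in ux, ut; cbv beta in ux, ut.
assert (dxu : forall x t, 0 <= t -> Rbar_lt t T ->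
  dx u x t = dosc c w (rho0 (A x t) - c) (Derive u0 (A x t)) t / jac c w rho0 u0 (A x t) t).
{ intros x t ht hT; exact (is_derive_unique _ _ _ (ux x t ht hT)). }
assert (dtu : forall x t, 0 < t -> Rbar_lt t T ->
  dt u x t = ddosc c w (e (A x t)) (u0 (A x t)) t -
    dosc c w (rho0 (A x t) - c) (Derive u0 (A x t)) t *
    dosc c w (e (A x t)) (u0 (A x t)) t / jac c w rho0 u0 (A x t) t).
{ intros x t ht hT; exact (is_derive_unique _ _ _ (ut x t ht hT)). }
assert (Ex : forall x t, 0 <= t -> Rbar_lt t T -> is_derive (fun y => E y t) x (rho x t - c)).
{ intros x t ht hT.
  destruct (eulerian_C1 k c w rho0 u0 e T (fun a t => ddosc c w (e a) (u0 a) t)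
    (fun a t => ddosc c w (rho0 a - c) (Derive u0 a) t)
    (fun a t => Derive (fun s => ddosc c w (e a) (u0 a) s) t) F hJ) as [Ex _].
  - intros; apply ddosc_derive_coeff; apply F.
  - intros; apply Derive_correct; unfold ddosc; auto_derive; easy.
  - intros a s _ _; apply (ddosc_continuity_2d c w (fun a => rho0 a - c) (Derive u0)); [|apply F].
    apply (continuous_minus rho0 (fun _ => c)); [apply F|apply continuous_const].
  - specialize (Ex x t ht hT); fold A in Ex.
    eapply is_derive_eq.
    + apply (is_derive_scal_l (V := R_NormedModule)
        (fun y => ddosc c w (e (A y t)) (u0 (A y t)) t)); exact Ex.
    + unfold scal; simpl; unfold mult; simpl.
      specialize (hJ (A x t) t ht hT).
      rewrite ddosc_osc by exact hw0; unfold rho.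
      set (J := jac c w rho0 u0 (A x t) t) in *.
      replace (osc c w (rho0 (A x t) - c) (Derive u0 (A x t)) t) with (J - 1)
        by (unfold J, jac; ring).
      rewrite hwkc; field; lra. }
assert (Elim : forall t x, 0 <= t -> Rbar_lt t T -> x = m_infty \/ x = p_infty ->
  is_lim (fun y => E y t) x 0).
{ intros t x ht hT hx.
  replace (Finite 0) with (Finite (0 * / k)) by (f_equal; ring).
  apply (is_lim_scal_r (fun y => ddosc c w (e (A y t)) (u0 (A y t)) t) (/ k) x 0).
  apply (eulerian_lim k c w rho0 u0 e T (fun a => ddosc c w (e a) (u0 a) t)); try easy.
  apply ddosc_lim_0; now apply F. }
assert (crhot : forall t x, 0 <= t -> Rbar_lt t T -> continuous (fun y => rho y t - c) x).
{ intros t x ht hT; apply (continuous_minus (fun y => rho y t) (fun _ => c));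
    [|apply continuous_const].
  apply continuity_pt_filterlim; now apply (C0_strip_point T). }
assert (hu : C1_strip T u).
{ split.
  - apply (eulerian_C0 k c w rho0 u0 e T (fun a t => dosc c w (e a) (u0 a) t) F hJ).
    intros; now apply dosc_continuity_2d.
  - exists (fun x t => dosc c w (rho0 (A x t) - c) (Derive u0 (A x t)) t /
      jac c w rho0 u0 (A x t) t).
    exists (fun x t => ddosc c w (e (A x t)) (u0 (A x t)) t -
      dosc c w (rho0 (A x t) - c) (Derive u0 (A x t)) t *
      dosc c w (e (A x t)) (u0 (A x t)) t / jac c w rho0 u0 (A x t) t).
    assert (cinv : forall a t, 0 <= t -> Rbar_lt t T ->
      continuity_2d_pt (fun a t => / jac c w rho0 u0 a t) a t).
    { intros a t ht hT; apply continuity_2d_pt_inv;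
        [now apply (jac_continuity_2d k c w rho0 u0 e)|].
      specialize (hJ a t ht hT); lra. }
    split; [|split; [|split; assumption]].
    + apply (eulerian_C0 k c w rho0 u0 e T (fun a t =>
        dosc c w (rho0 a - c) (Derive u0 a) t / jac c w rho0 u0 a t) F hJ).
      intros a t ht hT; apply (continuity_2d_pt_mult
        (fun a t => dosc c w (rho0 a - c) (Derive u0 a) t)); [|now apply cinv].
      now apply (dosc_jac_continuity_2d k c w rho0 u0 e).
    + apply (eulerian_C0 k c w rho0 u0 e T (fun a t => ddosc c w (e a) (u0 a) t -
        dosc c w (rho0 a - c) (Derive u0 a) t * dosc c w (e a) (u0 a) t /
        jac c w rho0 u0 a t) F hJ).
      intros a t ht hT; apply (continuity_2d_pt_minus
        (fun a t => ddosc c w (e a) (u0 a) t)); [now apply ddosc_continuity_2d|].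
      apply (continuity_2d_pt_mult (fun a t => dosc c w (rho0 a - c) (Derive u0 a) t *
        dosc c w (e a) (u0 a) t)); [|now apply cinv].
      apply (continuity_2d_pt_mult (fun a t => dosc c w (rho0 a - c) (Derive u0 a) t)).
      * now apply (dosc_jac_continuity_2d k c w rho0 u0 e).
      * now apply dosc_continuity_2d. }
assert (A0 : forall x, A x 0 = x).
{ intro x; pose proof (flow_label k c w rho0 u0 e x 0 F) as G.
  now rewrite flow_0 in G. }
exists rho, u, E; split.
- exact crho.
- exact hu.
- apply (eulerian_C0 k c w rho0 u0 e T (fun a t => ddosc c w (e a) (u0 a) t * / k) F hJ).
  intros; apply (continuity_2d_pt_mult (fun a t => ddosc c w (e a) (u0 a) t));
    [now apply ddosc_continuity_2d|apply continuity_2d_pt_const].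
- intro x; unfold rho, jac; rewrite osc_0, A0; field.
- intro x; unfold u; rewrite dosc_0, A0; reflexivity.
- intro a; exists (fun t => flow c w e u0 a t).
  now apply (flow_characteristic k c w rho0 u0 e T a).
(* The mass equation concerns any characteristic of [u]; uniqueness identifies it with the flow,
   along which the label is constantly [a]. *)
- intros a X hX t ht hT.
  assert (EX : forall s, 0 <= s -> Rbar_lt s T -> X s = flow c w e u0 a s /\ A (X s) s = a).
  { intros s hs hsT.
    assert (G : X s = flow c w e u0 a s).
    { apply (characteristic_unique T u a X (fun s => flow c w e u0 a s) hu hX); try easy.
      now apply (flow_characteristic k c w rho0 u0 e T a). }
    split; [exact G|]; rewrite G; now apply (label_flow k c w rho0 u0 e T). }
  destruct (Rbar_lt_near T t hT) as [d [hd Hd]].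
  destruct (EX t ltac:(lra) hT) as [_ EA].
  apply (is_derive_local (fun s => rho0 a * / jac c w rho0 u0 a s) _ t _ (Rmin d t)).
  + now apply Rmin_glb_lt.
  + intros y hy; pose proof (Rmin_l d t); pose proof (Rmin_r d t).
    assert (G : Rabs (y - t) < t) by lra; apply Rabs_def2 in G.
    destruct (EX y ltac:(lra) (Hd y ltac:(lra))) as [_ EA'].
    unfold rho; rewrite EA'; reflexivity.
  + specialize (hJ a t ltac:(lra) hT).
    eapply is_derive_eq.
    * apply (is_derive_scal (fun s => / jac c w rho0 u0 a s)).
      apply (is_derive_inv (fun s => jac c w rho0 u0 a s)); [now apply jac_derive_time|lra].
    * rewrite dxu by (try easy; lra).
      unfold rho; rewrite EA; field; lra.
- intros x t ht hT; rewrite dxu, dtu by (try easy; lra).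
  specialize (hJ (A x t) t ltac:(lra) hT); unfold u, E; field; lra.
- exact Ex.
- intros x t ht hT.
  (* [E] is a primitive of rho - c vanishing at both infinities, so this and the neutrality
     condition are read off from its boundary values. *)
  replace (E x t) with (E x t - 0) by ring.
  apply (is_RInt_gen_primitive (fun y => E y t)); try apply _; auto.
  + exact (Elim t m_infty ht hT (or_introl eq_refl)).
  + intros P HP; exact (locally_singleton _ _ HP).
- intros t ht hT.
  replace 0 with (0 - 0) by ring.
  apply (is_RInt_gen_primitive (fun y => E y t)); try apply _; auto.
  + exact (Elim t m_infty ht hT (or_introl eq_refl)).
  + exact (Elim t p_infty ht hT (or_intror eq_refl)).
- intros t ht hT.
  assert (G : forall x, x = m_infty \/ x = p_infty -> is_lim (fun y => rho y t) x c).
  { intros x hx.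
    apply (eulerian_lim k c w rho0 u0 e T (fun a => rho0 a / jac c w rho0 u0 a t)); try easy.
    replace (Finite c) with (Rbar_mult c (Rbar_inv 1)) by (simpl; f_equal; field).
    apply (is_lim_mult rho0 (fun a => / jac c w rho0 u0 a t)); [now apply F| |easy].
    apply is_lim_inv; [now apply (jac_lim k c w rho0 u0 e)|].
    intro G; injection G; lra. }
  split; apply G; auto.
- intros t ht hT.
  assert (G : forall x, x = m_infty \/ x = p_infty -> is_lim (fun y => u y t) x 0).
  { intros x hx.
    apply (eulerian_lim k c w rho0 u0 e T (fun a => dosc c w (e a) (u0 a) t)); try easy.
    apply dosc_lim_0; now apply F. }
  split; apply G; auto.
Qed.

(** * Eulerian formulas and regularity of the density *)

(** The improper integral lets both ends vary jointly. Comparing two lower ends with a common upper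
    end gives a Cauchy criterion at -oo, hence a limit [K] of the primitive there; the integral
    being 0 forces the same limit at +oo. *)
Lemma neutral_potential (g : R -> R) :
  (forall x, continuous g x) ->
  is_RInt_gen g (Rbar_locally m_infty) (Rbar_locally p_infty) 0 ->
  exists e : R -> R, (forall a, is_derive e a (g a)) /\
    forall x, x = m_infty \/ x = p_infty -> is_lim e x 0.
Proof.
intros hg hI.
set (H := fun x => RInt g 0 x).
assert (ex : forall a b, ex_RInt g a b).
{ intros; apply (ex_RInt_continuous (V := R_CompleteNormedModule)); intros; apply hg. }
assert (dH : forall a, is_derive H a (g a)).
{ intro a; apply (is_derive_RInt g H 0); [|apply hg].
  apply filter_forall; intro; apply (RInt_correct (V := R_CompleteNormedModule)), ex. }
assert (Hdiff : forall a b I, is_RInt g a b I -> I = H b - H a).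
{ intros a b I hI'; unfold H.
  pose proof (RInt_Chasles (V := R_CompleteNormedModule) g 0 a b (ex 0 a) (ex a b)) as G.
  rewrite (is_RInt_unique (V := R_CompleteNormedModule) _ _ _ _ hI') in G.
  unfold plus in G; simpl in G; lra. }
assert (small : forall eps, 0 < eps -> exists P Q : R -> Prop,
  Rbar_locally m_infty P /\ Rbar_locally p_infty Q /\
  forall a b, P a -> Q b -> Rabs (H b - H a) < eps).
{ intros eps he.
  destruct (hI _ (locally_ball 0 (mkposreal eps he))) as [P Q hP hQ HPQ].
  exists P, Q; split; [exact hP|split; [exact hQ|]]; intros a b ha hb.
  destruct (HPQ a b ha hb) as [I [hI1 hI2]]; simpl in hI1.
  rewrite <- (Hdiff a b I hI1).
  change (Rabs (I - 0) < eps) in hI2; now rewrite Rminus_0_r in hI2. }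
assert (K : exists K, filterlim H (Rbar_locally m_infty) (locally K)).
{ apply (filterlim_locally_cauchy (U := R_CompleteSpace) (F := Rbar_locally m_infty)).
  intro eps; pose proof (cond_pos eps).
  destruct (small (eps / 2) ltac:(lra)) as [P [Q [hP [hQ HPQ]]]].
  exists P; split; [exact hP|]; intros x y hx hy.
  destruct (filter_ex (F := Rbar_locally p_infty) Q hQ) as [b hb].
  pose proof (HPQ x b hx hb) as G1; pose proof (HPQ y b hy hb) as G2.
  apply Rabs_def2 in G1; apply Rabs_def2 in G2.
  change (Rabs (H y - H x) < eps); apply Rabs_def1; lra. }
destruct K as [K hK].
exists (fun a => H a - K); split.
- intro a; eapply is_derive_eq.
  + apply (is_derive_minus H (fun _ => K)); [apply dH|apply is_derive_const].
  + apply Rminus_0_r.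
- intros x [-> | ->]; apply filterlim_locally; intro eps.
  + apply (filterlim_locally H) with (eps := eps) in hK.
    apply (filter_imp (fun a => ball K eps (H a))); [|exact hK].
    intros a ha; change (Rabs (H a - K - 0) < eps); now rewrite Rminus_0_r.
  + pose proof (cond_pos eps).
    destruct (small (eps / 2) ltac:(lra)) as [P [Q [hP [hQ HPQ]]]].
    assert (he : 0 < eps / 2) by lra.
    apply (filterlim_locally H) with (eps := mkposreal _ he) in hK.
    destruct (filter_ex (F := Rbar_locally m_infty) _ (filter_and _ _ hP hK)) as [a [ha1 ha2]].
    apply (filter_imp Q); [|exact hQ]; intros b hb.
    specialize (HPQ a b ha1 hb); change (Rabs (H a - K) < eps / 2) in ha2.
    apply Rabs_def2 in HPQ; apply Rabs_def2 in ha2.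
    change (Rabs (H b - K - 0) < eps); apply Rabs_def1; lra.
Qed.

Lemma admissible_flow_data (k c : R) (rho0 u0 : R -> R) :
  0 < k -> 0 < c -> admissible_data c rho0 u0 ->
  exists e, flow_data k c (sqrt (k * c)) rho0 u0 e.
Proof.
intros hk hc D.
assert (hkc : 0 < k * c) by now apply Rmult_lt_0_compat.
assert (crho : forall a, continuous rho0 a).
{ intro a; apply (ex_derive_continuous rho0), (data_rho0_C1 _ _ _ D). }
destruct (neutral_potential (fun x => rho0 x - c)) as [e [de le]].
- intro a; apply (continuous_minus rho0 (fun _ => c)); [apply crho|apply continuous_const].
- apply D.
- exists e; split; auto.
  + now apply sqrt_lt_R0.
  + apply sqrt_sqrt; lra.
  + apply D.
  + intro a; apply Derive_correct, (data_u0_C1 _ _ _ D).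
  + intro a; apply (data_u0_C1 _ _ _ D).
  + intros x [-> | ->]; apply D.
  + intros x [-> | ->]; apply D.
  + intros x [-> | ->]; apply D.
Qed.

Lemma solution_jac_pos (k c w : R) (rho0 u0 e : R -> R) (T : Rbar) (rho u E : R -> R -> R) :
  flow_data k c w rho0 u0 e -> solution k c rho0 u0 T rho u E ->
  jac_pos_on c w rho0 u0 T.
Proof.
intros F S a t ht hT.
destruct (sol_characteristics _ _ _ _ _ _ _ _ S a) as [X hX].
now apply (solution_along_characteristic _ _ _ _ _ _ _ _ _ _ F S a X hX t).
Qed.

(** Every point lies on the characteristic of its label, so the formulas along characteristics hold
    at all points and can be differentiated in space. The velocity is obtained as the time
    derivative of that characteristic, hence at positive times. *)
Lemma solution_eulerian (k c w : R) (rho0 u0 e : R -> R) (T : Rbar)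
    (rho u E : R -> R -> R) (x t : R) :
  flow_data k c w rho0 u0 e -> solution k c rho0 u0 T rho u E ->
  0 <= t -> Rbar_lt t T ->
  let a := label c w e u0 x t in
  rho x t = rho0 a / jac c w rho0 u0 a t /\
  (0 < t -> u x t = dosc c w (e a) (u0 a) t /\
    dx u x t = dosc c w (rho0 a - c) (Derive u0 a) t / jac c w rho0 u0 a t).
Proof.
intros F S ht hT a.
assert (hw : w <> 0) by (pose proof (fd_w _ _ _ _ _ _ F); lra).
destruct (sol_characteristics _ _ _ _ _ _ _ _ S a) as [X hX].
pose proof (solution_along_characteristic _ _ _ _ _ _ _ _ _ _ F S a X hX) as H.
destruct (H t ht hT) as [E1 [_ E2]].
assert (EX : X t = x) by (rewrite E1; now apply (flow_label k c w rho0)).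
rewrite EX in E2; split; [exact E2|]; intro ht'; split.
- destruct hX as [_ [_ dX]]; specialize (dX t ht' hT); rewrite EX in dX.
  rewrite <- (is_derive_unique _ _ _ dX); apply is_derive_unique.
  destruct (Rbar_lt_near T t hT) as [d [hd Hd]].
  apply (is_derive_local (fun s => flow c w e u0 a s) _ t _ (Rmin d t)).
  + now apply Rmin_glb_lt.
  + intros y hy; pose proof (Rmin_l d t); pose proof (Rmin_r d t).
    assert (G : Rabs (y - t) < t) by lra; apply Rabs_def2 in G.
    symmetry; apply H; [lra|apply Hd; lra].
  + now apply flow_derive_time.
- rewrite <- EX; now apply (solution_gradient k c w rho0 u0 e T rho u E).
Qed.

Lemma continuity_2d_fst (f : R -> R) (a t : R) :
  continuous f a -> continuity_2d_pt (fun a _ => f a) a t.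
Proof.
intro hf; apply continuity_2d_pt_filterlim.
apply (continuous_comp (fst : R * R -> R) f); [apply continuous_fst|exact hf].
Qed.

(** The label derivative [Ja] of G involves u0''. For u0 of class C^2 and rho0 of class C^1 the
    quotient rho0 / G is therefore C^1 in (a, t), and so is rho in (x, t). *)
Lemma mass_equation (k c w : R) (rho0 u0 e : R -> R) (T : Rbar) (rho u E : R -> R -> R) :
  flow_data k c w rho0 u0 e -> Defs.C1 rho0 -> C2 u0 ->
  solution k c rho0 u0 T rho u E ->
  C1_strip T rho /\
  forall x t, 0 < t -> Rbar_lt t T ->
    dt rho x t + dx (fun y s => rho y s * u y s) x t = 0.
Proof.
intros F hrho0 [_ hu0] S.
assert (hw : w <> 0) by (pose proof (fd_w _ _ _ _ _ _ F); lra).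
pose proof (solution_jac_pos _ _ _ _ _ _ _ _ _ _ F S) as hJ.
set (A := label c w e u0).
set (J := jac c w rho0 u0).
set (Ja := fun a t => osc c w (Derive rho0 a) (Derive (Derive u0) a) t).
set (Jt := fun a t => dosc c w (rho0 a - c) (Derive u0 a) t).
set (V := fun a t => dosc c w (e a) (u0 a) t).
set (f := fun a t => rho0 a * / J a t).
set (fa := fun a t => Derive rho0 a * / J a t - rho0 a * Ja a t * (/ J a t * / J a t)).
set (ft := fun a t => - (rho0 a * Jt a t * (/ J a t * / J a t))).
assert (Jpos : forall a t, 0 <= t -> Rbar_lt t T -> 0 < J a t) by exact hJ.
assert (dJ : forall a t, is_derive (fun b => J b t) a (Ja a t)).
{ intros a t; eapply is_derive_eq.
  - apply (is_derive_plus (fun _ => 1) (fun b => osc c w (rho0 b - c) (Derive u0 b) t)).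
    + apply is_derive_const.
    + apply (osc_derive_coeff c w t (fun b => rho0 b - c) (Derive u0) a
        (Derive rho0 a) (Derive (Derive u0) a)); [|apply Derive_correct, hu0].
      eapply is_derive_eq.
      * apply (is_derive_minus rho0 (fun _ => c));
          [apply Derive_correct, hrho0|apply is_derive_const].
      * apply Rminus_0_r.
  - apply Rplus_0_l. }
assert (cI : forall a t, 0 <= t -> Rbar_lt t T -> continuity_2d_pt (fun a t => / J a t) a t).
{ intros a t ht hT; apply continuity_2d_pt_inv; [now apply (jac_continuity_2d k c w rho0 u0 e)|].
  specialize (Jpos a t ht hT); lra. }
assert (cJa : forall a t, continuity_2d_pt Ja a t).
{ intros; apply (osc_continuity_2d c w (Derive rho0) (Derive (Derive u0)));
    [apply hrho0|apply hu0]. }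
assert (cJt : forall a t, continuity_2d_pt Jt a t).
{ intros; now apply (dosc_jac_continuity_2d k c w rho0 u0 e). }
assert (cV : forall a t, continuity_2d_pt V a t).
{ intros; apply dosc_continuity_2d; eapply is_derive_continuous; apply F. }
assert (cr : forall a t, continuity_2d_pt (fun a _ => rho0 a) a t).
{ intros; apply continuity_2d_fst, F. }
assert (cfa : forall a t, 0 <= t -> Rbar_lt t T -> continuity_2d_pt fa a t).
{ intros a t ht hT; apply (continuity_2d_pt_minus (fun a t => Derive rho0 a * / J a t)
    (fun a t => rho0 a * Ja a t * (/ J a t * / J a t))).
  - apply (continuity_2d_pt_mult (fun a _ => Derive rho0 a) (fun a t => / J a t));
      [apply continuity_2d_fst, hrho0|now apply cI].
  - apply (continuity_2d_pt_mult (fun a t => rho0 a * Ja a t) (fun a t => / J a t * / J a t)).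
    + now apply (continuity_2d_pt_mult (fun a _ => rho0 a) Ja).
    + apply (continuity_2d_pt_mult (fun a t => / J a t) (fun a t => / J a t)); now apply cI. }
assert (cft : forall a t, 0 <= t -> Rbar_lt t T -> continuity_2d_pt ft a t).
{ intros a t ht hT; apply (continuity_2d_pt_opp (fun a t => rho0 a * Jt a t * (/ J a t * / J a t))).
  apply (continuity_2d_pt_mult (fun a t => rho0 a * Jt a t) (fun a t => / J a t * / J a t)).
  - now apply (continuity_2d_pt_mult (fun a _ => rho0 a) Jt).
  - apply (continuity_2d_pt_mult (fun a t => / J a t) (fun a t => / J a t)); now apply cI. }
destruct (eulerian_C1 k c w rho0 u0 e T f fa ft F hJ) as [rx rt].
{ intros a t ht hT; specialize (Jpos a t ht hT); eapply is_derive_eq.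
  - apply (is_derive_mult rho0 (fun b => / J b t) a (Derive rho0 a) (- Ja a t / J a t ^ 2)).
    + apply Derive_correct, hrho0.
    + apply (is_derive_inv (fun b => J b t)); [apply dJ|lra].
    + intros; apply Rmult_comm.
  - unfold plus, mult, fa; simpl; field; lra. }
{ intros a t ht hT; specialize (Jpos a t ht hT); eapply is_derive_eq.
  - apply (is_derive_scal (fun s => / J a s)).
    apply (is_derive_inv (fun s => J a s)); [now apply jac_derive_time|lra].
  - unfold ft, Jt; field; lra. }
{ exact cfa. }
fold A in rx, rt.
assert (rho_eq : forall x t, 0 <= t -> Rbar_lt t T -> rho x t = f (A x t) t).
{ intros x t ht hT; now apply (solution_eulerian k c w rho0 u0 e T rho u E x t). }
assert (rx' : forall x t, 0 <= t -> Rbar_lt t T ->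
  is_derive (fun y => rho y t) x (fa (A x t) t / J (A x t) t)).
{ intros x t ht hT; apply (is_derive_ext (fun y => f (A y t) t)); [|now apply rx].
  intro y; symmetry; now apply rho_eq. }
assert (rt' : forall x t, 0 < t -> Rbar_lt t T -> is_derive (fun s => rho x s) t
  (ft (A x t) t - fa (A x t) t * V (A x t) t / J (A x t) t)).
{ intros x t ht hT; destruct (Rbar_lt_near T t hT) as [d [hd Hd]].
  apply (is_derive_local (fun s => f (A x s) s) _ t _ (Rmin d t)); [now apply Rmin_glb_lt| |now apply rt].
  intros y hy; pose proof (Rmin_l d t); pose proof (Rmin_r d t).
  assert (G : Rabs (y - t) < t) by lra; apply Rabs_def2 in G.
  symmetry; apply rho_eq; [lra|apply Hd; lra]. }
split.
- split; [apply S|].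
  exists (fun x t => fa (A x t) t / J (A x t) t).
  exists (fun x t => ft (A x t) t - fa (A x t) t * V (A x t) t / J (A x t) t).
  split; [|split; [|split; assumption]].
  + apply (eulerian_C0 k c w rho0 u0 e T (fun a t => fa a t / J a t) F hJ).
    intros; apply (continuity_2d_pt_mult fa (fun a t => / J a t)); [now apply cfa|now apply cI].
  + apply (eulerian_C0 k c w rho0 u0 e T (fun a t => ft a t - fa a t * V a t / J a t) F hJ).
    intros; apply (continuity_2d_pt_minus ft (fun a t => fa a t * V a t / J a t)); [now apply cft|].
    apply (continuity_2d_pt_mult (fun a t => fa a t * V a t) (fun a t => / J a t)); [|now apply cI].
    apply (continuity_2d_pt_mult fa V); [now apply cfa|apply cV].
- intros x t ht hT; replace (dt rho x t) with (ft (A x t) t - fa (A x t) t * V (A x t) t / J (A x t) t)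
    by (symmetry; exact (is_derive_unique _ _ _ (rt' x t ht hT))).
  destruct (solution_eulerian k c w rho0 u0 e T rho u E x t F S ltac:(lra) hT) as [Er Eu].
  destruct (Eu ht) as [Eu1 Eu2]; fold A in Er, Eu1, Eu2.
  assert (D : is_derive (fun y => rho y t * u y t) x
    (fa (A x t) t / J (A x t) t * u x t + rho x t * dx u x t)).
  { apply (is_derive_mult (fun y => rho y t) (fun y => u y t)).
    - apply rx'; [lra|easy].
    - apply (C1_strip_dx T u (sol_u_C1 _ _ _ _ _ _ _ _ S)); [lra|easy].
    - intros; apply Rmult_comm. }
  replace (dx (fun y s => rho y s * u y s) x t)
    with (fa (A x t) t / J (A x t) t * u x t + rho x t * dx u x t)
    by (symmetry; exact (is_derive_unique _ _ _ D)).
  rewrite Eu1, Eu2, Er.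
  specialize (Jpos (A x t) t ltac:(lra) hT).
  fold (J (A x t) t); fold (Jt (A x t) t); fold (V (A x t) t).
  unfold ft; field; lra.
Qed.

Theorem theorem3p1 (k c : R) (rho0 u0 : R -> R)
  (hk : 0 < k) (hc : 0 < c) (hdata : admissible_data c rho0 u0) :
  (* threshold *)
  ((exists rho u E, solution k c rho0 u0 p_infty rho u E) <->
     subcritical k c rho0 u0)
  /\
  (* behaviour in time along every characteristic which is not at the
     equilibrium (rho, u_x) = (c, 0) *)
  (subcritical k c rho0 u0 ->
     forall rho u E, solution k c rho0 u0 p_infty rho u E ->
     forall a X, characteristic p_infty u a X ->
       (rho0 a <> c \/ Derive u0 a <> 0) ->
       oscillates_around c (fun t => rho (X t) t) /\
       ~ decays (fun t => dx u (X t) t))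
  /\
  (* finite-time breakdown *)
  (~ subcritical k c rho0 u0 ->
     exists Tb : R, 0 < Tb /\
       (exists rho u E, solution k c rho0 u0 Tb rho u E) /\
       exists a, forall rho u E, solution k c rho0 u0 Tb rho u E ->
         forall X, characteristic Tb u a X ->
           unbounded_before Tb (fun t => rho (X t) t) /\
           unbounded_before Tb (fun t => dx u (X t) t))
  /\
  (* for u0 of class C^2 the mass equation holds pointwise *)
  (C2 u0 ->
     forall T rho u E, solution k c rho0 u0 T rho u E ->
       C1_strip T rho /\
       forall x t, 0 < t -> Rbar_lt t T ->
         dt rho x t + dx (fun y s => rho y s * u y s) x t = 0).
Proof.
destruct (admissible_flow_data k c rho0 u0 hk hc hdata) as [e F].
split; [split|split; [|split]].
- intros [rho [u [E S]]].
  apply (jac_pos_subcritical _ _ _ _ _ _ F); intros a t ht.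
  now apply (solution_jac_pos _ _ _ _ _ _ _ _ _ _ F S).
- intro H; apply (eulerian_solution _ _ _ _ _ _ _ F).
  intros a t _ _; exact (subcritical_jac_pos _ _ _ _ _ _ F H a t).
- intros _ rho u E; exact (behaviour_along_characteristic _ _ _ _ _ _ rho u E F).
- intro H; destruct (critical_time _ _ _ _ _ _ F H) as [Tb [hTb [below [a ha]]]].
  exists Tb; split; [exact hTb|split].
  + apply (eulerian_solution _ _ _ _ _ _ _ F).
    intros b t ht hT; apply below; split; [exact ht|exact hT].
  + exists a; intros rho u E S; exact (breakdown _ _ _ _ _ _ _ _ _ _ _ F hTb ha S).
- intros hu T rho u E.
  exact (mass_equation _ _ _ _ _ _ _ _ _ _ F (data_rho0_C1 _ _ _ hdata) hu).
Qed.
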